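(* Let $H$ be a Hopf algebra with bijective antipode, $V$ a left Yetter-Drinfeld module over $H$ and $A=\mathfrak B(V)\#H$. Let $\eta:V\otimes V\to\Bbbk$ be an $H$-invariant linear functional such that $\sigma=e^{\tilde\eta}$ is a multiplicative $2$-cocycle on $A$. Let $x_1,x_2\in V$ be homogeneous elements with $\delta(x_1)=h_1\otimes x_1$ and $\delta(x_2)=h_2\otimes x_2$, where $h_1,h_2\in G(H)$, and denote $z_1=x_1\#1$, $z_2=x_2\#1\in A$. Then $\sigma(z_1,z_2)=\eta(x_1,x_2)$. In particular, in $A_\sigma$ it holds that $$z_1\cdot_\sigma z_2=\eta(x_1,x_2)(1-h_1h_2)+z_1z_2 .$$
   Context: $\Bbbk$ is an algebraically closed field of characteristic zero; $G(H)$ is the group of group-like elements of $H$, and $\delta$ is the $H$-coaction on $V$. $\mathfrak B(V)=\bigoplus_{n\ge0}\mathfrak B^n(V)$ is the Nichols algebra of $V$ (the quotient of $T(V)$ by the largest homogeneous two-sided ideal, generated in degrees $\ge2$, that is also a coideal) and $A=\mathfrak B(V)\#H$ is the bosonization (Majid-Radford biproduct), graded by $A_n=\mathfrak B^n(V)\#H$; $h\in H$ is identified with $1\#h\in A$. $\eta:V\otimes V\to\Bbbk$ is $H$-invariant if $\eta(h_{(1)}\cdot x,h_{(2)}\cdot y)=\varepsilon(h)\eta(x,y)$ for all $h\in H$, $x,y\in V$. Then $\tilde\eta:A\otimes A\to\Bbbk$ is defined by $\tilde\eta(A_a\otimes A_b)=0$ for $(a,b)\ne(1,1)$ and $\tilde\eta(x\#h,y\#h')=\eta(x,h\cdot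 y)\varepsilon(h')$ for $x,y\in V$, $h,h'\in H$; and $e^{\tilde\eta}=\sum_{i\ge0}\tilde\eta^{*i}/i!$ (convolution powers). A multiplicative $2$-cocycle on $A$ is a convolution invertible linear map $\sigma:A\otimes A\to\Bbbk$ with $\sigma(b_{(1)},c_{(1)})\sigma(a,b_{(2)}c_{(2)})=\sigma(a_{(1)},b_{(1)})\sigma(a_{(2)}b_{(2)},c)$ and $\sigma(a,1)=\varepsilon(a)=\sigma(1,a)$. $A_\sigma$ is the Hopf algebra equal to $A$ as a coalgebra with product $a\cdot_\sigma b=\sigma(a_{(1)},b_{(1)})a_{(2)}b_{(2)}\sigma^{-1}(a_{(3)},b_{(3)})$. *)

(* Defs.v *)
From HB Require Import structures.
From mathcomp Require Import all_boot all_order all_algebra.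
From mathcomp Require Import freeg.
From mathcomp Require Import boolp classical_sets functions cardinality fsbigop.

Set Implicit Arguments.
Unset Strict Implicit.
Unset Printing Implicit Defensive.

Import GRing.Theory.
Local Open Scope ring_scope.
Local Open Scope quotient_scope.

Section Quotient.
Variables (k : fieldType) (V : lmodType k).

Inductive span (S : V -> Prop) : V -> Prop :=
| span0 : span S 0
| span_cons a s v : S s -> span S v -> span S (a *: s + v).

Variable S : V -> Prop.

Lemma span_gen s : S s -> span S s.
Proof. by move=> Ss; have := span_cons 1 Ss (span0 S); rewrite scale1r addr0. Qed.

Lemma spanD u v : span S u -> span S v -> span S (u + v).
Proof.
elim=> [|a s w Ss _ IH] Sv; first by rewrite add0r.
by rewrite -addrA; apply: span_cons => //; apply: IH.
Qed.

Lemma spanZ a v : span S v -> span S (a *: v).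
Proof.
elim=> [|b s w Ss _ IH]; first by rewrite scaler0; constructor.
by rewrite scalerDr scalerA; apply: span_cons.
Qed.

Lemma spanN v : span S v -> span S (- v).
Proof. by move=> Sv; rewrite -scaleN1r; apply: spanZ. Qed.

Definition span_equiv (x y : V) : bool := `[< span S (x - y) >].

Lemma span_equiv_is_equiv : equiv_class_of span_equiv.
Proof.
split=> [x|x y|y x z].
- by apply/asboolP; rewrite subrr; constructor.
- by apply/asboolP/asboolP => /spanN; rewrite opprB.
- by move=> /asboolP xy /asboolP yz; apply/asboolP; rewrite -(subrKA y); exact: spanD.
Qed.

Canonical span_equiv_equiv := EquivRelPack span_equiv_is_equiv.

Definition quot_sort := {eq_quot span_equiv}.
HB.instance Definition _ := Choice.on quot_sort.
HB.instance Definition _ := EqQuotient.on quot_sort.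

Definition qclass (v : V) : quot_sort := \pi_quot_sort v.

Lemma qclassP u v : qclass u = qclass v <-> span S (u - v).
Proof.
split; first by move/eqmodP/asboolP.
by move=> uv; apply/eqmodP/asboolP.
Qed.

Lemma qclassK (q : quot_sort) : qclass (repr q) = q.
Proof. exact: reprK. Qed.

Definition qadd (p q : quot_sort) := qclass (repr p + repr q).
Definition qopp (p : quot_sort) := qclass (- repr p).
Definition qscale a (p : quot_sort) := qclass (a *: repr p).

Lemma qrepr v : span S (repr (qclass v) - v).
Proof. by apply/qclassP; rewrite qclassK. Qed.

Lemma qclassD u v : qadd (qclass u) (qclass v) = qclass (u + v).
Proof. by apply/qclassP; rewrite opprD addrACA; apply: spanD; apply: qrepr. Qed.

Lemma qclassN u : qopp (qclass u) = qclass (- u).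
Proof. by apply/qclassP; rewrite -opprD; apply: spanN; apply: qrepr. Qed.

Lemma qclassZ a u : qscale a (qclass u) = qclass (a *: u).
Proof. by apply/qclassP; rewrite -scalerBr; apply: spanZ; apply: qrepr. Qed.

Lemma qaddA : associative qadd.
Proof.
move=> p q r; rewrite -(qclassK p) -(qclassK q) -(qclassK r).
by rewrite !qclassD addrA.
Qed.
Lemma qaddC : commutative qadd.
Proof. by move=> p q; rewrite /qadd addrC. Qed.
Lemma qadd0 : left_id (qclass 0) qadd.
Proof. by move=> p; rewrite -(qclassK p) qclassD add0r. Qed.
Lemma qaddN : left_inverse (qclass 0) qopp qadd.
Proof. by move=> p; rewrite -(qclassK p) qclassN qclassD addNr. Qed.

HB.instance Definition _ :=
  GRing.isZmodule.Build quot_sort qaddA qaddC qadd0 qaddN.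

Lemma qscaleA a b p : qscale a (qscale b p) = qscale (a * b) p.
Proof. by rewrite -(qclassK p) !qclassZ scalerA. Qed.
Lemma qscale1 : left_id 1 qscale.
Proof. by move=> p; rewrite -(qclassK p) qclassZ scale1r. Qed.
Lemma qscaleDr : right_distributive qscale +%R.
Proof.
move=> a p q; rewrite -(qclassK p) -(qclassK q).
by rewrite [X in qscale a X]qclassD !qclassZ [RHS]qclassD scalerDr.
Qed.
Lemma qscaleDl p : {morph qscale^~ p : a b / a + b}.
Proof. by move=> a b; rewrite -(qclassK p) !qclassZ [RHS]qclassD scalerDl. Qed.

HB.instance Definition _ :=
  GRing.Zmodule_isLmodule.Build k quot_sort qscaleA qscale1 qscaleDr qscaleDl.

Lemma qclass_is_linear : linear qclass.
Proof. by move=> a u v; rewrite -qclassD -qclassZ. Qed.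
HB.instance Definition _ := GRing.isLinear.Build k V quot_sort _ qclass qclass_is_linear.

Lemma qlift_well (U : lmodType k) (f : {linear V -> U}) v :
  (forall s, S s -> f s = 0) -> f (repr (qclass v)) = f v.
Proof.
move=> fS; apply/eqP; rewrite -subr_eq0 -linearB; apply/eqP.
elim: (qrepr v) => [|a s w Ss _ IH]; first exact: linear0.
by rewrite linearD linearZ /= fS // IH scaler0 addr0.
Qed.

End Quotient.

Definition quotient (k : fieldType) (V : lmodType k) (S : V -> Prop) : lmodType k :=
  quot_sort S.

(* V ⊗ W: the vector space on V * W modulo bilinearity. *)
Section Tensor.
Variables (k : fieldType) (V W : lmodType k).

Definition bilinear_rel (r : {freeg (V * W) / k}) : Prop :=
  (exists a v v' w, r = << (a *: v + v', w) >> - (a *: << (v, w) >> + << (v', w) >>)) \/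
  (exists a v w w', r = << (v, a *: w + w') >> - (a *: << (v, w) >> + << (v, w') >>)).

Definition tensor : lmodType k := quotient bilinear_rel.

Definition tens (v : V) (w : W) : tensor := qclass bilinear_rel << (v, w) >>.

(* The linear map on V ⊗ W induced by f; meaningful when f is bilinear. *)
Definition tlift (U : lmodType k) (f : V -> W -> U) (t : tensor) : U :=
  fglift (fun p => f p.1 p.2) (repr t).

End Tensor.

Notation "V ⊗ W" := (tensor V W) (at level 40, left associativity) : type_scope.
Notation "v ⊗ w" := (tens v w) (at level 40, left associativity) : ring_scope.

(* Sweedler notation: if t is the sum of the v_i ⊗ w_i, then
   \sw_(v, w <- t) E v w is the sum of the E v_i w_i. *)
Notation "\sw_ ( v , w <- t ) E" := (tlift (fun v w => E) t)
  (at level 41, v name, w name, t at level 40, E at level 41,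
   format "'[' \sw_ ( v ,  w  <-  t ) '/  '  E ']'") : ring_scope.

Section TensorTheory.
Variables (k : fieldType) (V W U : lmodType k).

Lemma tensDl a (v v' : V) (w : W) : (a *: v + v') ⊗ w = a *: (v ⊗ w) + v' ⊗ w.
Proof.
rewrite /tens -linearP; apply/qclassP/span_gen; left.
by exists a, v, v', w.
Qed.

Lemma tensDr a (v : V) (w w' : W) : v ⊗ (a *: w + w') = a *: (v ⊗ w) + v ⊗ w'.
Proof.
rewrite /tens -linearP; apply/qclassP/span_gen; right.
by exists a, v, w, w'.
Qed.

Definition bilinear_map (f : V -> W -> U) : Prop :=
  (forall w, linear (f^~ w)) /\ (forall v, linear (f v)).

End TensorTheory.

Lemma tens_bilinear (k : fieldType) (V W : lmodType k) : bilinear_map (@tens k V W).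
Proof.
by split=> [w a v v'|v a w w']; [exact: tensDl | exact: tensDr].
Qed.

Section Freeg.
Variables (k : fieldType) (K : choiceType) (U : lmodType k) (g : K -> U).

Lemma fglift_is_linear : linear (fglift g : {freeg K / k} -> U).
Proof.
have addf : {morph (fglift g : {freeg K / k} -> U) : x y / x + y}.
  have subf := lift_is_additive g.
  have f0 : fglift g (0 : {freeg K / k}) = 0 by rewrite -(subrr 0) subf subrr.
  have fN y : fglift g (- y : {freeg K / k}) = - fglift g y.
    by rewrite -[- y]add0r subf f0 sub0r.
  by move=> x y; rewrite -[y in LHS]opprK subf fN opprK.
move=> a u v; rewrite addf; congr (_ + _).
rewrite -[u in LHS]freeg_sumE -[u in RHS]freeg_sumE.
have f0 : fglift g (0 : {freeg K / k}) = 0.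
  by apply: (addIr (fglift g (0 : {freeg K / k}))); rewrite -addf !add0r.
elim: (dom u) => [|x s IH]; first by rewrite !big_nil scaler0 f0 scaler0.
rewrite !big_cons scalerDr !addf IH [RHS]scalerDr; congr (_ + _).
suff -> : a *: << coeff x u *g x >> = << a * coeff x u *g x >> :> {freeg K / k}.
  by rewrite !liftU scalerA.
by apply/eqP/freeg_eqP => y; rewrite coeffZ !coeffU mulrA.
Qed.
HB.instance Definition _ :=
  GRing.isLinear.Build k {freeg K / k} U _ (fglift g) fglift_is_linear.

Lemma fgliftE x : fglift g (<< x >> : {freeg K / k}) = g x.
Proof. by rewrite liftU scale1r. Qed.

Lemma freeg_span (D : {freeg K / k}) : span (fun r => exists x, r = << x >>) D.
Proof.
rewrite -(freeg_sumE D); elim: (dom D) => [|x s IH].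
  by rewrite big_nil; constructor.
rewrite big_cons; apply: spanD => //.
suff -> : << coeff x D *g x >> = coeff x D *: << x >> :> {freeg K / k}.
  by apply/spanZ/span_gen; exists x.
by apply/eqP/freeg_eqP => y; rewrite coeffZ !coeffU mul1r.
Qed.

End Freeg.

Lemma fglift_lincomb (k : fieldType) (K : choiceType) (U : lmodType k)
    (f g : K -> U) a (D : {freeg K / k}) :
  fglift (fun x => a *: f x + g x) D = a *: fglift f D + fglift g D.
Proof.
elim: (freeg_span D) => [|b s v [x ->] _ IH].
  by rewrite !linear0 addr0.
have lin h : fglift h (b *: << x >> + v) = b *: h x + fglift h v.
  by rewrite linearP /= fgliftE.
by rewrite !lin IH !scalerDr !scalerA [b * a]mulrC addrACA.
Qed.

Section TensorLift.
Variables (k : fieldType) (V W U : lmodType k) (f : V -> W -> U).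
Hypothesis flin : bilinear_map f.

Let F : {linear {freeg (V * W) / k} -> U} := fglift (fun p => f p.1 p.2).

Lemma bilinear_rel_lift r : bilinear_rel r -> F r = 0.
Proof.
case: flin => fl fr [] [a [x [y [z ->]]]];
  rewrite linearB linearD linearZ /= !fgliftE /=.
- by rewrite (fl z) subrr.
- by rewrite (fr x) subrr.
Qed.

Lemma tliftE v w : tlift f (v ⊗ w) = f v w.
Proof.
rewrite /tlift /tens (qlift_well (f := F)); first exact: fgliftE.
exact: bilinear_rel_lift.
Qed.

Lemma tlift_linear : linear (tlift f).
Proof.
move=> a u v; rewrite -(qclassK u) -(qclassK v) -linearP /tlift.
by rewrite !(qlift_well (f := F)) ?linearP //; exact: bilinear_rel_lift.
Qed.

End TensorLift.

Lemma tlift_lincomb (k : fieldType) (V W U : lmodType k) (f g : V -> W -> U) a t :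
  \sw_(v, w <- t) (a *: f v w + g v w)
  = a *: (\sw_(v, w <- t) f v w) + \sw_(v, w <- t) g v w.
Proof. exact: fglift_lincomb. Qed.

Lemma tensor_span (k : fieldType) (V W : lmodType k) (t : V ⊗ W) :
  span (fun s => exists v w, s = v ⊗ w) t.
Proof.
rewrite -(qclassK t); elim: (freeg_span (repr t)) => [|a s D [[v w] ->] _ IH].
  by rewrite linear0; constructor.
by rewrite linearP; apply: span_cons => //; exists v, w.
Qed.

(* The tensor algebra of V: the vector space on the words in V modulo
   multilinearity in each letter; T^n(V) is spanned by the words of size n. *)
Section TensorAlgebra.
Variables (k : fieldType) (V : lmodType k).

Definition multilinear_rel (r : {freeg (seq V) / k}) : Prop :=
  exists u v a x y, r = << u ++ (a *: x + y) :: v >>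
    - (a *: << u ++ x :: v >> + << u ++ y :: v >>).

Definition talg : lmodType k := quotient multilinear_rel.

Definition word (w : seq V) : talg := qclass multilinear_rel << w >>.

(* The linear map on T(V) induced by f; meaningful when f is multilinear. *)
Definition wlift (U : lmodType k) (f : seq V -> U) (t : talg) : U :=
  fglift f (repr t).

Definition multilinear_map (U : lmodType k) (f : seq V -> U) : Prop :=
  forall u v a x y,
    f (u ++ (a *: x + y) :: v) = a *: f (u ++ x :: v) + f (u ++ y :: v).

Section Lift.
Variables (U : lmodType k) (f : seq V -> U).
Hypothesis flin : multilinear_map f.

Let F : {linear {freeg (seq V) / k} -> U} := fglift f.

Lemma multilinear_rel_lift r : multilinear_rel r -> F r = 0.
Proof.
move=> [u [v [a [x [y ->]]]]].
by rewrite linearB linearD linearZ /= !fgliftE flin subrr.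
Qed.

Lemma wliftE w : wlift f (word w) = f w.
Proof.
rewrite /wlift /word (qlift_well (f := F)); first exact: fgliftE.
exact: multilinear_rel_lift.
Qed.

Lemma wlift_linear : linear (wlift f).
Proof.
move=> a u v; rewrite -(qclassK u) -(qclassK v) -linearP /wlift.
by rewrite !(qlift_well (f := F)) ?linearP //; exact: multilinear_rel_lift.
Qed.

End Lift.

Lemma word_multilinear : multilinear_map word.
Proof.
move=> u v a x y; rewrite /word -linearP; apply/qclassP/span_gen.
by exists u, v, a, x, y.
Qed.

Definition tone : talg := word [::].
Definition tmul (s t : talg) : talg :=
  wlift (fun u => wlift (fun v => word (u ++ v)) t) s.

Definition thomog (n : nat) : talg -> Prop :=
  span (fun s => exists2 w, size w = n & s = word w).

Definition tideal (S : talg -> Prop) : talg -> Prop :=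
  span (fun t => exists a s b, S s /\ t = tmul (tmul a s) b).

Definition tcounit : talg -> k^o := wlift (fun w => (nilp w)%:R).

End TensorAlgebra.

Lemma linear_0 (k : fieldType) (V U : lmodType k) (f : V -> U) : linear f -> f 0 = 0.
Proof.
by move=> fl; have := fl (-1) 0 0; rewrite scaler0 addr0 scaleN1r addNr.
Qed.

Section TensorAlgebraTheory.
Variables (k : fieldType) (V : lmodType k).

Lemma wlift_lincomb (U : lmodType k) (f g : seq V -> U) a t :
  wlift (fun w => a *: f w + g w) t = a *: wlift f t + wlift g t.
Proof. exact: fglift_lincomb. Qed.

Lemma talg_span (t : talg V) : span (fun s => exists w, s = word w) t.
Proof.
rewrite -(qclassK t); elim: (freeg_span (repr t)) => [|a s D [w ->] _ IH].
  by rewrite linear0; constructor.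
by rewrite linearP; apply: span_cons => //; exists w.
Qed.

Lemma word_cat_multilinear (u : seq V) : multilinear_map (fun v => word (u ++ v)).
Proof. by move=> u' v a x y; rewrite !catA word_multilinear. Qed.

Lemma tmul_word (u v : seq V) : tmul (word u) (word v) = word (u ++ v).
Proof.
rewrite /tmul wliftE ?wliftE //; first exact: word_cat_multilinear.
move=> u' v' a x y; rewrite !wliftE; try exact: word_cat_multilinear.
by rewrite -!catA /= word_multilinear.
Qed.

Lemma tmul_bilinear : bilinear_map (@tmul k V).
Proof.
split=> [t a s s'|s a t t'].
  apply: wlift_linear => u v b x y.
  rewrite -wlift_lincomb; congr (wlift _ _); apply: funext => w.
  by rewrite -!catA /= word_multilinear.
rewrite /tmul -wlift_lincomb; congr (wlift _ _); apply: funext => u.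
by rewrite (wlift_linear (word_cat_multilinear u)).
Qed.

End TensorAlgebraTheory.

Section Hopf.
Variable k : fieldType.

Record hopfAlg : Type := HopfAlg {
  hopf_alg :> algType k;
  comul : {linear hopf_alg -> (hopf_alg ⊗ hopf_alg)%type};
  counit : {linear hopf_alg -> k^o};
  antip : {linear hopf_alg -> hopf_alg};
  comulA : forall h,
    \sw_(h1, h2 <- comul h) \sw_(h11, h12 <- comul h1) h11 ⊗ (h12 ⊗ h2)
    = \sw_(h1, h2 <- comul h) \sw_(h21, h22 <- comul h2) h1 ⊗ (h21 ⊗ h22);
  counitl : forall h, \sw_(h1, h2 <- comul h) (counit h1 *: h2) = h;
  counitr : forall h, \sw_(h1, h2 <- comul h) (counit h2 *: h1) = h;
  comul1 : comul 1 = 1 ⊗ 1;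
  comulM : forall g h, comul (g * h)
    = \sw_(g1, g2 <- comul g) \sw_(h1, h2 <- comul h) (g1 * h1) ⊗ (g2 * h2);
  counit1 : counit 1 = 1;
  counitM : forall g h, counit (g * h) = counit g * counit h;
  antipl : forall h, \sw_(h1, h2 <- comul h) (antip h1 * h2) = counit h *: 1;
  antipr : forall h, \sw_(h1, h2 <- comul h) (h1 * antip h2) = counit h *: 1
}.

Definition grouplike (H : hopfAlg) (g : H) : Prop :=
  comul H g = g ⊗ g /\ counit H g = 1.

Record ydMod (H : hopfAlg) : Type := YDMod {
  yd_mod :> lmodType k;
  act : H -> yd_mod -> yd_mod;
  coact : {linear yd_mod -> (H ⊗ yd_mod)%type};
  act_bilinear : bilinear_map act;
  act1 : forall v, act 1 v = v;
  actM : forall g h v, act (g * h) v = act g (act h v);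
  coactA : forall v,
    \sw_(g, v0 <- coact v) \sw_(g1, g2 <- comul H g) g1 ⊗ (g2 ⊗ v0)
    = \sw_(g, v0 <- coact v) \sw_(g', v00 <- coact v0) g ⊗ (g' ⊗ v00);
  coact1 : forall v, \sw_(g, v0 <- coact v) (counit H g *: v0) = v;
  coact_act : forall h v, coact (act h v)
    = \sw_(h1, h23 <- comul H h) \sw_(h2, h3 <- comul H h23)
        \sw_(g, v0 <- coact v) (h1 * g * antip H h3) ⊗ act h2 v0
}.

End Hopf.

Section Nichols.
Variables (k : fieldType) (H : hopfAlg k) (V : ydMod H).

Local Notation T := (talg V).

(* T(V) is a Hopf algebra in the category of Yetter-Drinfeld modules, with the
   diagonal action and the codiagonal coaction. *)
Fixpoint act_word (w : seq V) (h : H) : T :=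
  if w is x :: w' then
    \sw_(h1, h2 <- comul H h) tmul (word [:: act h1 x]) (act_word w' h2)
  else counit H h *: tone V.
Definition tact (h : H) : T -> T := wlift (act_word^~ h).

Fixpoint coact_word (w : seq V) : H ⊗ T :=
  if w is x :: w' then
    \sw_(g, x0 <- coact V x) \sw_(g', t0 <- coact_word w')
      (g * g') ⊗ tmul (word [:: x0]) t0
  else 1 ⊗ tone V.
Definition tcoact : T -> H ⊗ T := wlift coact_word.

(* (a ⊗ b)(c ⊗ d) = a (b_(-1) . c) ⊗ b_(0) d *)
Definition braided_mul (s t : T ⊗ T) : T ⊗ T :=
  \sw_(a, b <- s) \sw_(c, d <- t) \sw_(g, b0 <- tcoact b)
    (tmul a (tact g c) ⊗ tmul b0 d).

(* The algebra map T(V) -> T(V) ⊗ T(V), for the braided product, under which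
   the elements of V are primitive. *)
Fixpoint comul_word (w : seq V) : T ⊗ T :=
  if w is x :: w' then
    braided_mul (word [:: x] ⊗ tone V + tone V ⊗ word [:: x]) (comul_word w')
  else tone V ⊗ tone V.
Definition tcomul : T -> T ⊗ T := wlift comul_word.

Definition tcoideal (I : T -> Prop) : Prop :=
  (forall t, I t -> tcounit t = 0) /\
  (forall t, I t -> span (fun u => exists a b, (I a \/ I b) /\ u = a ⊗ b) (tcomul t)).

(* S consists of homogeneous elements, so the ideal it generates is homogeneous. *)
Definition nichols_admissible (I : T -> Prop) : Prop :=
  (exists S : T -> Prop,
     (forall s, S s -> exists2 n, (2 <= n)%N & thomog n s) /\
     (forall t, I t <-> tideal S t)) /\
  tcoideal I.

(* The quotient of T(V) by the sum of all admissible ideals; this sum is itself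
   admissible, so it is the largest of them. *)
Definition nichols_gen (t : T) : Prop := exists2 I, nichols_admissible I & I t.
Definition nichols : lmodType k := quotient nichols_gen.

Definition npi (t : T) : nichols := qclass nichols_gen t.

(* The structure maps induced from T(V); they do not depend on the chosen
   representatives, the ideal being a coideal and a Yetter-Drinfeld submodule. *)
Definition nmul (b c : nichols) : nichols := npi (tmul (repr b) (repr c)).
Definition none : nichols := npi (tone V).
Definition nact (h : H) (b : nichols) : nichols := npi (tact h (repr b)).
Definition ncoact (b : nichols) : H ⊗ nichols :=
  \sw_(g, t <- tcoact (repr b)) g ⊗ npi t.
Definition ncomul (b : nichols) : nichols ⊗ nichols :=
  \sw_(s, t <- tcomul (repr b)) npi s ⊗ npi t.
Definition ncounit (b : nichols) : k^o := tcounit (repr b).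

Definition nincl (x : V) : nichols := npi (word [:: x]).

End Nichols.

(* Convolution, multiplicative 2-cocycles and the twisted product only involve the
   operations of a bialgebra, not its axioms. *)
Record bialgOps (k : fieldType) : Type := BialgOps {
  bsort :> lmodType k;
  bmul : bsort -> bsort -> bsort;
  bone : bsort;
  bcomul : bsort -> bsort ⊗ bsort;
  bcounit : bsort -> k^o
}.

Section Cocycles.
Variables (k : fieldType) (A : bialgOps k).

Definition conv (f g : A ⊗ A -> k^o) (t : A ⊗ A) : k^o :=
  \sw_(a, b <- t) \sw_(a1, a2 <- bcomul a) \sw_(b1, b2 <- bcomul b)
    (f (a1 ⊗ b1) * g (a2 ⊗ b2) : k^o).

Definition conv1 (t : A ⊗ A) : k^o :=
  \sw_(a, b <- t) (bcounit a * bcounit b : k^o).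

Definition conv_pow (f : A ⊗ A -> k^o) (n : nat) : A ⊗ A -> k^o :=
  iter n (conv f) conv1.

(* The sum is over the i with nonzero term; there are finitely many of them at
   each t when f vanishes on A_0 ⊗ A + A ⊗ A_0 for a coalgebra grading of A. *)
Definition conv_exp (f : A ⊗ A -> k^o) (t : A ⊗ A) : k^o :=
  \sum_(i \in [set: nat]) (i`!%:R^-1 * conv_pow f i t).

Definition conv_inverse (f g : A ⊗ A -> k^o) : Prop :=
  [/\ linear g, conv f g = conv1 & conv g f = conv1].

Definition conv_inv (f : A ⊗ A -> k^o) : A ⊗ A -> k^o :=
  if pselect (exists g, conv_inverse f g) is left ex then projT1 (cid ex)
  else fun=> 0.

Definition mult_2cocycle (s : A ⊗ A -> k^o) : Prop :=
  [/\ linear s,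
      exists g, conv_inverse s g,
      forall a b c : A,
        \sw_(b1, b2 <- bcomul b) \sw_(c1, c2 <- bcomul c)
          (s (b1 ⊗ c1) * s (a ⊗ bmul b2 c2) : k^o)
        = \sw_(a1, a2 <- bcomul a) \sw_(b1, b2 <- bcomul b)
          (s (a1 ⊗ b1) * s (bmul a2 b2 ⊗ c) : k^o)
    & forall a : A, s (a ⊗ bone A) = bcounit a /\ s (bone A ⊗ a) = bcounit a].

Definition twist_mul (s : A ⊗ A -> k^o) (a b : A) : A :=
  \sw_(a1, a23 <- bcomul a) \sw_(a2, a3 <- bcomul a23)
  \sw_(b1, b23 <- bcomul b) \sw_(b2, b3 <- bcomul b23)
    ((s (a1 ⊗ b1) * conv_inv s (a3 ⊗ b3)) *: bmul a2 b2).

End Cocycles.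

Section Bosonization.
Variables (k : fieldType) (H : hopfAlg k) (V : ydMod H).

Local Notation B := (nichols V).

(* B(V) # H, with b # h written b ⊗ h *)
Definition bosonization : bialgOps k := {|
  bsort := (B ⊗ H)%type;
  bmul := fun s t =>
    \sw_(b, h <- s) \sw_(c, g <- t) \sw_(h1, h2 <- comul H h)
      nmul b (nact h1 c) ⊗ (h2 * g);
  bone := none V ⊗ 1;
  bcomul := fun s =>
    \sw_(b, h <- s) \sw_(b1, b2 <- ncomul b) \sw_(g, b20 <- ncoact b2)
    \sw_(h1, h2 <- comul H h) (b1 ⊗ (g * h1)) ⊗ (b20 ⊗ h2);
  bcounit := fun s => \sw_(b, h <- s) (ncounit b * counit H h : k^o)
|}.

Definition smash (b : B) (h : H) : bosonization := b ⊗ h.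

Definition bos_homog (n : nat) : bosonization -> Prop :=
  span (fun a => exists t h, thomog n t /\ a = smash (npi t) h).

Definition invariant_form (eta : {linear (V ⊗ V)%type -> k^o}) : Prop :=
  forall h (x y : V),
    \sw_(h1, h2 <- comul H h) eta (act h1 x ⊗ act h2 y)
    = counit H h * eta (x ⊗ y).

(* The projection of B(V) onto its degree 1 part V; independent of the
   representative because the ideal is generated in degrees >= 2 (nproj1E). *)
Definition nproj1 (b : B) : V :=
  wlift (fun w => if w is [:: x] then x else 0) (repr b).

(* eta_tilde_linear, eta_tilde_homog and eta_tildeE below give the usual
   characterization: linear, zero on A_m ⊗ A_n unless m = n = 1, and
   (x # h, y # h') |-> eta (x, h . y) eps (h') for x, y in V. *)
Definition eta_tilde (eta : {linear (V ⊗ V)%type -> k^o}) (t : bosonization ⊗ bosonization) : k^o :=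
  \sw_(a, a' <- t) \sw_(b, h <- a) \sw_(b', h' <- a')
    (eta (nproj1 b ⊗ act h (nproj1 b')) * counit H h' : k^o).

End Bosonization.

Section BosonizationTheory.
Variables (k : fieldType) (H : hopfAlg k) (V : ydMod H).

Let pword (w : seq V) : V := if w is [:: x] then x else 0.

Lemma pword_multilinear : multilinear_map pword.
Proof.
move=> [|z u] [|z' v] a x y //=; rewrite ?scaler0 ?addr0 //.
by case: u => [|? ?]; rewrite /= scaler0 addr0.
by case: u => [|? ?]; rewrite /= scaler0 addr0.
Qed.

Lemma pword_linear : linear (wlift pword).
Proof. exact: wlift_linear pword_multilinear. Qed.
HB.instance Definition _ :=
  GRing.isLinear.Build k (talg V) V _ (wlift pword) pword_linear.

Lemma thomog_proj1 n (t : talg V) : n != 1 -> thomog n t -> wlift pword t = 0.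
Proof.
move=> n1; elim=> [|a s v [w sw ->] _ IH]; first exact: linear0.
rewrite linearP /= IH addr0 (wliftE pword_multilinear).
by case: w sw n1 => [|x [|y w]] <-; rewrite /= ?scaler0.
Qed.

Lemma proj1_tideal (S : talg V -> Prop) t :
    (forall s, S s -> exists2 n, (2 <= n)%N & thomog n s) ->
  tideal S t -> wlift pword t = 0.
Proof.
move=> SP; elim=> [|a s v [b [s' [c [/SP[n n2 Hn] ->]]]] _ IH]; first exact: linear0.
rewrite linearP /= IH addr0 -[RHS](scaler0 _ a); congr (_ *: _).
case: (tmul_bilinear V) => mull mulr.
elim: (talg_span c) => [|x _ c' [w ->] _ IHc].
  by rewrite (linear_0 (mulr _)) linear0.
rewrite mulr linearP /= IHc addr0 -[RHS](scaler0 _ x); congr (_ *: _).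
elim: (talg_span b) => [|y _ b' [u ->] _ IHb].
  by rewrite (linear_0 (mull _)) (linear_0 (mull _)) linear0.
rewrite mull mull linearP /= IHb addr0 -[RHS](scaler0 _ y); congr (_ *: _).
elim: Hn => [|z _ s'' [v' sv ->] _ IHs].
  by rewrite (linear_0 (mulr _)) (linear_0 (mull _)) linear0.
rewrite mulr mull linearP /= IHs addr0 !tmul_word (wliftE pword_multilinear).
suff -> : pword ((u ++ v') ++ w) = 0 by rewrite scaler0.
have : (2 <= size ((u ++ v') ++ w))%N.
  by rewrite -catA size_cat size_cat sv addnCA (leq_trans n2) // leq_addr.
by case: (_ ++ _) => [|? [|? ?]].
Qed.

Lemma nproj1E t : nproj1 (npi t : nichols V) = wlift pword t.
Proof.
apply: (qlift_well (f := wlift pword)) => s [I [[S [SP IP]] _] /IP].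
exact: proj1_tideal.
Qed.

Lemma nproj1_linear : linear (@nproj1 k H V).
Proof.
move=> a b c; rewrite -(qclassK b) -(qclassK c) -linearP.
by rewrite !nproj1E linearP.
Qed.

Variable eta : {linear (V ⊗ V)%type -> k^o}.

Let E (b : nichols V) (h : H) (b' : nichols V) (h' : H) : k^o :=
  eta (nproj1 b ⊗ act h (nproj1 b')) * counit H h'.

Lemma eta_tilde_bilinearr b h : bilinear_map (E b h).
Proof.
case: (act_bilinear V) => actl actr.
split=> [h' a b' c|b' a h' g].
  by rewrite /E nproj1_linear actr tensDr linearP mulrDl -scalerAl.
by rewrite /E linearP mulrDr /= -scalerAr.
Qed.

Lemma eta_tilde_bilinearl a' :
  bilinear_map (fun b h => \sw_(b', h' <- a') E b h b' h').
Proof.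
case: (act_bilinear V) => actl actr.
split=> [h a b c|b a h g]; rewrite -tlift_lincomb /=;
  congr (tlift _ _); apply: funext => b'; apply: funext => h'; rewrite /E.
  by rewrite nproj1_linear tensDl linearP mulrDl -scalerAl.
by rewrite actl tensDr linearP mulrDl -scalerAl.
Qed.

Lemma eta_tilde_bilinear :
  bilinear_map (fun a a' : nichols V ⊗ H =>
    \sw_(b, h <- a) \sw_(b', h' <- a') E b h b' h').
Proof.
split=> [a'|a]; first exact: tlift_linear (eta_tilde_bilinearl a').
move=> x c c'; rewrite -tlift_lincomb; congr (tlift _ _).
apply: funext => b; apply: funext => h.
by rewrite (tlift_linear (eta_tilde_bilinearr b h)).
Qed.

Lemma eta_tilde_linear : linear (eta_tilde eta).
Proof. exact: tlift_linear eta_tilde_bilinear. Qed.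

Lemma eta_tilde_smash (b c : nichols V) h g :
  eta_tilde eta (smash b h ⊗ smash c g)
  = eta (nproj1 b ⊗ act h (nproj1 c)) * counit H g.
Proof.
rewrite /eta_tilde /smash (tliftE eta_tilde_bilinear).
by rewrite (tliftE (eta_tilde_bilinearl _)) (tliftE (eta_tilde_bilinearr _ _)).
Qed.

Lemma eta_tildeE (x y : V) (h h' : H) :
  eta_tilde eta (smash (nincl x) h ⊗ smash (nincl y) h')
  = eta (x ⊗ act h y) * counit H h'.
Proof. by rewrite eta_tilde_smash !nproj1E !(wliftE pword_multilinear). Qed.

Lemma eta_tilde_homog m n a b : bos_homog (V := V) m a -> bos_homog n b ->
  (m, n) <> (1%N, 1%N) -> eta_tilde eta (a ⊗ b) = 0.
Proof.
move=> Ha Hb mn; rewrite /eta_tilde (tliftE eta_tilde_bilinear).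
case: eta_tilde_bilinear => etal etar.
elim: Ha => [|x _ a' [s [h [Hs ->]]] _ IHa]; first exact: linear_0 (etal b).
rewrite (etal b) IHa addr0 -[RHS](scaler0 _ x); congr (_ *: _).
elim: Hb => [|y _ b' [t [g [Ht ->]]] _ IHb]; first exact: linear_0 (etar _).
rewrite (etar _) IHb addr0 -[RHS](scaler0 _ y); congr (_ *: _).
rewrite (tliftE (eta_tilde_bilinearl _)) (tliftE (eta_tilde_bilinearr _ _)) /E.
rewrite !nproj1E; case: (act_bilinear V) => actl actr; case: (tens_bilinear V V) => tensl tensr.
case: (eqVneq m 1%N) => [m1|m1]; last first.
  by rewrite (thomog_proj1 m1 Hs) (linear_0 (tensl _)) linear0 mul0r.
have n1 : n != 1%N by apply/eqP => n1; apply: mn; rewrite m1 n1.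
rewrite (thomog_proj1 n1 Ht) (linear_0 (actr h)).
by rewrite (linear_0 (tensr _)) linear0 mul0r.
Qed.

End BosonizationTheory.

(* Main.v *)
Require Import Defs.
From mathcomp Require Import all_boot all_order all_algebra.
From mathcomp Require Import freeg.
From mathcomp Require Import boolp classical_sets fsbigop.

(** In the bosonization A = B(V) # H the element z_i = x_i # 1 is skew primitive, with
    coproduct z_i ⊗ 1 + h_i ⊗ z_i, and the form [eta_tilde eta] vanishes unless both
    arguments have degree 1. Expanding the coproducts, the i-th convolution power of
    the form at (z_1, z_2) is its value there times the (i - 1)-st power at (1, 1), so
    in the exponential only i = 1 contributes and sigma(z_1, z_2) = eta(x_1, x_2). The
    same expansion gives sigma(z_1, h_2) = sigma(h_1, z_2) = 0 and
    sigma(h_1, h_2) = 1, and evaluating sigma * sigma^-1 gives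
    sigma^-1(z_1, z_2) = - eta(x_1, x_2). The product of z_1 and z_2 in A_sigma is then
    read off from its nine terms ([twist_mul_primitive]).

    Most of the work is to justify these expansions. The structure maps of A are given
    by formulas on representatives, and Sweedler sums can be evaluated only when they
    are known to be linear; hence the action and the coaction of H have to descend
    from T(V) to B(V). The defining ideal of B(V) is the largest homogeneous ideal
    and coideal generated in degrees at least 2, and its stability under H,
    which this description does not include, has to be proved. If I is an admissible ideal, then
    so are the span of the h . t ([tact_image_admissible]) and the span of the
    f(t_(-1)) t_0 ([hit_image_admissible]), for t in I, h in H and f a functional on H;
    both therefore lie in the largest one. These spans are coideals because the
    coproduct of T(V) is H-linear and H-colinear ([tcomul_tact], [tcoact_tcomul]),
    which rests on the Yetter-Drinfeld condition for T(V) ([tact_tcoact]). They are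
    ideals by antipode identities, with S on one side and its inverse on the other
    ([antipV_skew]); this is where the bijectivity of S enters. Finally, functionals
    on H separate the elements of H ⊗ B(V) ([tensor_eq0]), which turns stability under
    all functionals into stability under the coaction. *)

Set Implicit Arguments.
Unset Strict Implicit.
Unset Printing Implicit Defensive.

Import GRing.Theory.
Local Open Scope ring_scope.

(** * Linear maps and Sweedler sums *)

Section Lin.
Variable k : fieldType.
Implicit Types V W U X : lmodType k.

(** The same proposition as [linear], under a head symbol of its own: the tactic
    [islin] below works by matching on it. *)
Definition lin V U (f : V -> U) : Prop :=
  forall a x y, f (a *: x + y) = a *: f x + f y.

Lemma bilP V W U (f : V -> W -> U) :
  (forall w, lin (fun v => f v w)) -> (forall v, lin (f v)) -> bilinear_map f.
Proof. by split. Qed.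

Lemma lin_linear V U (f : {linear V -> U}) : lin f.
Proof. exact: linearP. Qed.

Lemma lin_id V : lin (fun x : V => x).
Proof. by []. Qed.

Lemma lin_comp V U W (L : U -> W) (f : V -> U) :
  lin L -> lin f -> lin (fun x => L (f x)).
Proof. by move=> Ll fl a x y; rewrite fl Ll. Qed.

Lemma lin_bill V W U X (op : V -> W -> U) (f : X -> V) w :
  bilinear_map op -> lin f -> lin (fun x => op (f x) w).
Proof. by move=> [opl _] fl a x y; rewrite fl opl. Qed.

Lemma lin_bilr V W U X (op : V -> W -> U) (f : X -> W) v :
  bilinear_map op -> lin f -> lin (fun x => op v (f x)).
Proof. by move=> [_ opr] fl a x y; rewrite fl opr. Qed.

Lemma lin_sw V W U X (f : X -> V -> W -> U) t :
  (forall v w, lin (fun x => f x v w)) -> lin (fun x => tlift (f x) t).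
Proof.
move=> fl a x y; rewrite -tlift_lincomb; congr (tlift _ _).
by apply/funext => v; apply/funext => w; apply: fl.
Qed.

Lemma lin_tlift V W U (f : V -> W -> U) : bilinear_map f -> lin (tlift f).
Proof. exact: tlift_linear. Qed.

Lemma lin_add V U (f g : V -> U) : lin f -> lin g -> lin (fun x => f x + g x).
Proof. by move=> fl gl a x y; rewrite fl gl scalerDr addrACA. Qed.

Lemma mul_bil (A : algType k) : bilinear_map (fun x y : A => x * y).
Proof.
split=> [w a x y|v a x y]; first by rewrite mulrDl scalerAl.
by rewrite mulrDr scalerAr.
Qed.

Lemma lin_scalel V U (f : V -> k^o) (u : U) : lin f -> lin (fun x => f x *: u).
Proof. by move=> fl a x y; rewrite fl scalerDl -scalerA. Qed.

Lemma lin_scaler V U (f : V -> U) (c : k) : lin f -> lin (fun x => c *: f x).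
Proof. by move=> fl a x y; rewrite fl scalerDr !scalerA mulrC. Qed.

Lemma bil_l V W U (f : V -> W -> U) w : bilinear_map f -> lin (fun v => f v w).
Proof. by case=> fl _; exact: fl. Qed.
Lemma bil_r V W U (f : V -> W -> U) v : bilinear_map f -> lin (f v).
Proof. by case=> _ fr; exact: fr. Qed.

Lemma lin_letter V : lin (fun x : V => word [:: x]).
Proof. exact: (@word_multilinear k V [::] [::]). Qed.

Lemma lin_wlift V U (f : seq V -> U) : multilinear_map f -> lin (wlift f).
Proof. exact: wlift_linear. Qed.

Lemma lin0 V U (f : V -> U) : lin f -> f 0 = 0.
Proof. exact: linear_0. Qed.
Lemma linZ V U (f : V -> U) a x : lin f -> f (a *: x) = a *: f x.
Proof. by move=> fl; have := fl a x 0; rewrite (lin0 fl) !addr0. Qed.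
Lemma linD V U (f : V -> U) x y : lin f -> f (x + y) = f x + f y.
Proof. by move=> fl; have := fl 1 x y; rewrite !scale1r. Qed.

End Lin.

Arguments lin : simpl never.
Create HintDb bilin.
#[export] Hint Extern 0 (bilinear_map _) => exact: mul_bil : bilin.
#[export] Hint Extern 0 (bilinear_map _) => exact: tens_bilinear : bilin.
#[export] Hint Extern 0 (bilinear_map _) => exact: tmul_bilinear : bilin.
#[export] Hint Extern 0 (bilinear_map _) => exact: act_bilinear : bilin.
#[export] Hint Extern 0 (lin _) => exact: lin_linear : bilin.

Ltac bilin_hint := solve [assumption | auto with bilin nocore].

(** A Sweedler sum over a tensor [t] is defined through an arbitrary representative
    of [t], so it can be evaluated only when the summand is bilinear. These side
    conditions are discharged by recursion on the term: each subterm in which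
    the variable occurs must be the argument of a known linear or bilinear map. *)
Ltac islin :=
  lazymatch goal with
  | |- bilinear_map _ => first [bilin_hint | apply: bilP; intro; cbv beta; islin]
  | |- lin ?f => let f' := eval cbv beta in f in change (lin f'); islin_step
  | |- forall _, _ => intro; cbv beta; islin
  | |- _ => idtac
  end
with islin_step :=
  match goal with
  | |- lin (fun x => x) => exact: lin_id
  | |- lin (fun x => word [:: @?f x]) =>
      apply: (lin_comp (L := fun y => word [:: y]) (f := f)); [exact: lin_letter | islin]
  | |- lin (fun x => tlift _ (@?t x)) =>
      lazymatch t with fun _ => _ => apply: lin_sw; do 2 intro; islin end
  | |- lin (fun x => tlift (@?f x) (@?t x)) =>
      lazymatch f with fun _ => ?f' =>
      apply: (lin_comp (L := tlift f') (f := t)); [apply: lin_tlift; islin | islin] end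
  | |- lin (fun x => @?f x + @?g x) => apply: (lin_add (f := f) (g := g)); islin
  | |- lin (fun x => @GRing.scale _ _ (@?f x) (@?u x)) =>
      lazymatch u with fun _ => ?u' => apply: (lin_scalel u' (f := f)); islin end
  | |- lin (fun x => @GRing.scale _ _ (@?c x) (@?f x)) =>
      lazymatch c with fun _ => ?c' => apply: (lin_scaler c' (f := f)); islin end
  | |- lin (fun x => ?op (@?f x) (@?c x) (@?d x)) =>
      lazymatch c with fun _ => ?c' => lazymatch d with fun _ => ?d' =>
      apply: (lin_comp (L := fun y => op y c' d') (f := f)); [bilin_hint | islin] end end
  | |- lin (fun x => ?op (@?c x) (@?f x) (@?d x)) =>
      lazymatch c with fun _ => ?c' => lazymatch d with fun _ => ?d' =>
      apply: (lin_comp (L := fun y => op c' y d') (f := f)); [bilin_hint | islin] end end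
  | |- lin (fun x => ?op (@?f x) (@?c x)) =>
      lazymatch c with fun _ => ?c' =>
      apply: (lin_bill (op := op) (f := f) c'); [bilin_hint | islin] end
  | |- lin (fun x => ?op (@?c x) (@?f x)) =>
      lazymatch c with fun _ => ?c' =>
      first [apply: (lin_bilr (op := op) (f := f) c'); [bilin_hint | islin]
            |apply: (lin_comp (L := op c') (f := f)); [bilin_hint | islin] ] end
  | |- lin (fun x => ?op (@?f x)) =>
      apply: (lin_comp (L := op) (f := f)); [bilin_hint | islin]
  | |- lin (tlift _) => apply: lin_tlift; islin
  | |- lin ?f => bilin_hint
  | |- lin (?op ?c) => apply: (bil_r (f := op)); bilin_hint
  end.

(** Rearrangements that keep the tensors fixed (extensionality, exchange of two sums,
    pushing a linear map inside a sum) hold for every summand, because a Sweedler sum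
    is a finite sum over the chosen representatives. *)

Section Sweedler.
Variable k : fieldType.
Implicit Types V W U X Y : lmodType k.

Lemma eq_tlift V W U (f g : V -> W -> U) t :
  (forall v w, f v w = g v w) -> tlift f t = tlift g t.
Proof. by move=> fg; congr (tlift _ _); apply/funext => v; apply/funext => w. Qed.

Lemma fglift_map (K : choiceType) U X (L : U -> X) (f : K -> U) (D : {freeg K / k}) :
  lin L -> L (fglift f D) = fglift (fun x => L (f x)) D.
Proof.
move=> Ll; elim: (freeg_span D) => [|a s E [x ->] _ IH].
  by rewrite !(lin0 (lin_linear (fglift _))) (lin0 Ll).
by rewrite !linearP Ll IH /= !fgliftE.
Qed.

Lemma tlift_map V W U X (L : U -> X) (f : V -> W -> U) t :
  lin L -> L (tlift f t) = tlift (fun v w => L (f v w)) t.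
Proof. by move=> Ll; exact: fglift_map. Qed.

Lemma tliftZ V W U c (f : V -> W -> U) t :
  \sw_(v, w <- t) (c *: f v w) = c *: \sw_(v, w <- t) f v w.
Proof. by rewrite -(tlift_map (L := fun y => c *: y)) //; islin. Qed.

Lemma tliftD V W U (f g : V -> W -> U) t :
  \sw_(v, w <- t) (f v w + g v w)
  = (\sw_(v, w <- t) f v w) + \sw_(v, w <- t) g v w.
Proof.
rewrite -[X in _ = X + _]scale1r -tlift_lincomb.
by apply: eq_tlift => v w; rewrite scale1r.
Qed.

Lemma fglift_exchange (K K' : choiceType) U (f : K -> K' -> U)
    (D : {freeg K / k}) (E : {freeg K' / k}) :
  fglift (fun x => fglift (f x) E) D = fglift (fun y => fglift (f^~ y) D) E.
Proof.
elim: (freeg_span D) => [|a s D' [x ->] _ IH].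
  rewrite linear0; elim: (freeg_span E) => [|b t E' [y ->] _ IHE].
    by rewrite linear0.
  by rewrite linearP /= -IHE fgliftE linear0 scaler0 addr0.
rewrite linearP /= IH fgliftE -fglift_lincomb; congr (fglift _ _).
by apply/funext => y; rewrite linearP /= fgliftE.
Qed.

Lemma tlift_exchange V W X Y U (f : V -> W -> X -> Y -> U) s t :
  \sw_(v, w <- s) \sw_(x, y <- t) f v w x y
  = \sw_(x, y <- t) \sw_(v, w <- s) f v w x y.
Proof.
exact: (fglift_exchange (fun (p : V * W) (q : X * Y) => f p.1 p.2 q.1 q.2)).
Qed.

Lemma span_tlift V W U (S : U -> Prop) (f : V -> W -> U) t :
  (forall v w, Defs.span S (f v w)) -> Defs.span S (tlift f t).
Proof.
move=> Sf; rewrite /tlift; elim: (freeg_span (repr t)) => [|a s D [x ->] _ IH].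
  by rewrite linear0; constructor.
by rewrite linearP /= fgliftE; apply: spanD => //; apply: spanZ.
Qed.

End Sweedler.

(** * Hopf algebras with bijective antipode *)

Section HopfTheory.
Variables (k : fieldType) (H : hopfAlg k).
Local Notation Δ := (comul H).
Local Notation ε := (counit H).
Local Notation S := (antip H).

(** The Hopf axioms are equations between tensors; applying a multilinear map to
    both sides turns each of them into a rewriting rule for Sweedler sums. *)
Lemma coassoc (U : lmodType k) (F : H -> H -> H -> U) h :
  (forall y z, lin (fun x => F x y z)) -> (forall x z, lin (fun y => F x y z)) ->
  (forall x y, lin (fun z => F x y z)) ->
  \sw_(h1, h2 <- Δ h) \sw_(h11, h12 <- Δ h1) F h11 h12 h2
  = \sw_(h1, h2 <- Δ h) \sw_(h21, h22 <- Δ h2) F h1 h21 h22.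
Proof.
move=> F1 F2 F3.
have G x : bilinear_map (F x) by apply: bilP => y; [exact: F2 | exact: F3].
have G' : bilinear_map (fun x yz => tlift (F x) yz).
  by apply: bilP => y; [apply: lin_sw => v w; exact: F1 | exact: lin_tlift].
have := congr1 (tlift (fun x yz => tlift (F x) yz)) (comulA h).
do 2 rewrite (tlift_map _ _ (lin_tlift G')).
under eq_tlift => h1 h2 do rewrite (tlift_map _ _ (lin_tlift G')).
move=> E.
transitivity (\sw_(h1, h2 <- Δ h) \sw_(v, w <- Δ h1)
  tlift (fun x yz => tlift (F x) yz) (v ⊗ (w ⊗ h2))).
  by apply: eq_tlift => h1 h2; apply: eq_tlift => v w; rewrite !tliftE.
rewrite E; apply: eq_tlift => h1 h2; rewrite (tlift_map _ _ (lin_tlift G')).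
by apply: eq_tlift => v w; rewrite !tliftE.
Qed.

Lemma counitlE (U : lmodType k) (F : H -> U) h :
  lin F -> \sw_(h1, h2 <- Δ h) ε h1 *: F h2 = F h.
Proof.
move=> Fl; rewrite -[in RHS](counitl h) (tlift_map _ _ Fl).
by apply: eq_tlift => v w; rewrite linZ.
Qed.

Lemma counitrE (U : lmodType k) (F : H -> U) h :
  lin F -> \sw_(h1, h2 <- Δ h) ε h2 *: F h1 = F h.
Proof.
move=> Fl; rewrite -[in RHS](counitr h) (tlift_map _ _ Fl).
by apply: eq_tlift => v w; rewrite linZ.
Qed.

Lemma antiplE (U : lmodType k) (F : H -> U) h :
  lin F -> \sw_(h1, h2 <- Δ h) F (S h1 * h2) = ε h *: F 1.
Proof. by move=> Fl; rewrite -(linZ _ _ Fl) -antipl (tlift_map _ _ Fl). Qed.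

Lemma antiprE (U : lmodType k) (F : H -> U) h :
  lin F -> \sw_(h1, h2 <- Δ h) F (h1 * S h2) = ε h *: F 1.
Proof. by move=> Fl; rewrite -(linZ _ _ Fl) -antipr (tlift_map _ _ Fl). Qed.

Lemma comulME (U : lmodType k) (F : H -> H -> U) g h :
  bilinear_map F ->
  tlift F (Δ (g * h))
  = \sw_(g1, g2 <- Δ g) \sw_(h1, h2 <- Δ h) F (g1 * h1) (g2 * h2).
Proof.
move=> Fl; rewrite comulM (tlift_map _ _ (lin_tlift Fl)); apply: eq_tlift => g1 g2.
rewrite (tlift_map _ _ (lin_tlift Fl)); apply: eq_tlift => h1 h2.
by rewrite tliftE.
Qed.

Lemma antip1 : S 1 = 1.
Proof.
by have := antipl (1 : H); rewrite comul1 tliftE ?mulr1 ?counit1 ?scale1r //; islin.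
Qed.

Lemma antiplME (U : lmodType k) (F : H -> U) g h : lin F ->
  \sw_(g1, g2 <- Δ g) \sw_(h1, h2 <- Δ h) F (S (g1 * h1) * (g2 * h2))
  = ε g *: (ε h *: F 1).
Proof.
move=> Fl; rewrite scalerA -counitM -(antiplE _ Fl) comulME //; islin.
Qed.

(** Both sides are convolution inverses of the multiplication: they are compared
    through the sum of the S(g_1 h_1) g_2 h_2 S(h_3) S(g_3), contracted from the
    right for the first side and from the left for the second. *)
Lemma antipM g h : S (g * h) = S h * S g.
Proof.
pose X := \sw_(g1, g2 <- Δ g) \sw_(g21, g22 <- Δ g2)
  \sw_(h1, h2 <- Δ h) \sw_(h21, h22 <- Δ h2)
  (S (g1 * h1) * (g21 * ((h21 * S h22) * S g22))).
transitivity X.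
  symmetry; rewrite /X.
  under eq_tlift => g1 g2.
    under eq_tlift => g21 g22.
      under eq_tlift => h1 h2.
        rewrite (antiprE (F := fun y => S (g1 * h1) * (g21 * (y * S g22)))); last by islin.
        over.
      rewrite (counitrE (F := fun h1 => S (g1 * h1) * (g21 * (1 * S g22)))); last by islin.
      rewrite mul1r; over.
    rewrite (antiprE (F := fun y => S (g1 * h) * y)); last by islin.
    over.
  by rewrite (counitrE (F := fun g1 => S (g1 * h) * 1)) ?mulr1 //; islin.
rewrite /X.
rewrite -(coassoc (F := fun g1 g2 g3 => \sw_(h1, h2 <- Δ h) \sw_(h21, h22 <- Δ h2)
  (S (g1 * h1) * (g2 * ((h21 * S h22) * S g3))))); try by islin.
under eq_tlift => g1 g2.
  under eq_tlift => g11 g12.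
    rewrite -(coassoc (F := fun h1 h2 h3 => S (g11 * h1) * (g12 * ((h2 * S h3) * S g2)))); try by islin.
    over.
  rewrite tlift_exchange.
  under eq_tlift => h1 h2.
    under eq_tlift => g11 g12 do
      under eq_tlift => h11 h12 do rewrite -!mulrA (mulrA g12) (mulrA (S _)).
    rewrite (antiplME _ _ (F := fun y => y * (S h2 * S g2))); last by islin.
    rewrite mul1r; over.
  rewrite tliftZ.
  rewrite (counitlE (F := fun h2 => S h2 * S g2)); last by islin.
  over.
by rewrite (counitlE (F := fun g2 => S h * S g2)); last by islin.
Qed.

(** The inverse of S is an antipode for the opposite coproduct: apply S to the
    identity and use that S reverses products. *)
Lemma antipV_skew (T : H -> H) : cancel T S -> cancel S T ->
  lin T /\ forall (U : lmodType k) (F : H -> U) h, lin F ->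
    \sw_(h1, h2 <- Δ h) F (h2 * T h1) = ε h *: F 1.
Proof.
move=> TK KT; have Tl : lin T.
  by move=> a x y; rewrite -{1}(TK x) -{1}(TK y) -linearP KT.
split=> // U F h Fl; rewrite -(tlift_map _ _ Fl) -(linZ _ _ Fl); congr (F _).
apply: (can_inj KT); rewrite (tlift_map _ _ (lin_linear S)) linearZ /= antip1.
rewrite -antipr; apply: eq_tlift => h1 h2; by rewrite antipM TK.
Qed.
End HopfTheory.

(** * The tensor algebra as a bialgebra in Yetter-Drinfeld modules *)

Section TensorAlgebra.
Variables (k : fieldType) (V : lmodType k).
Local Notation "s ∗ t" := (tmul s t) (at level 40, left associativity).

Lemma talg_eq (U : lmodType k) (f g : talg V -> U) :
  lin f -> lin g -> (forall w, f (word w) = g (word w)) -> f =1 g.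
Proof.
move=> fl gl fg t; elim: (talg_span t) => [|a s u [w ->] _ IH].
  by rewrite !lin0.
by rewrite fl gl IH fg.
Qed.

Lemma word_cons x (w : seq V) : word (x :: w) = word [:: x] ∗ word w.
Proof. by rewrite tmul_word. Qed.

Lemma tmul1l (t : talg V) : tone V ∗ t = t.
Proof. by move: t; apply: talg_eq => [||w]; rewrite ?tmul_word //; islin. Qed.

Lemma tmul1r (t : talg V) : t ∗ tone V = t.
Proof. by move: t; apply: talg_eq => [||w]; rewrite ?tmul_word ?cats0 //; islin. Qed.

Lemma tmulA (r s t : talg V) : r ∗ (s ∗ t) = r ∗ s ∗ t.
Proof.
move: r; apply: talg_eq => [||u]; try by islin.
move: s; apply: talg_eq => [||v]; try by islin.
move: t; apply: talg_eq => [||w]; try by islin.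
by rewrite !tmul_word catA.
Qed.

End TensorAlgebra.

Section YD.
Variables (k : fieldType) (H : hopfAlg k) (V : ydMod H).
Local Notation T := (talg V).
Local Notation Δ := (comul H).
Local Notation ε := (counit H).
Local Notation S := (antip H).
Local Notation δ := (coact V).
Local Notation "s ∗ t" := (tmul s t) (at level 40, left associativity).
Local Notation ι x := (word [:: x]).

Lemma lin_act_word w : lin (@act_word k H V w).
Proof. by elim: w => [|x w IH] /=; islin. Qed.

Lemma act_word_multilinear h : multilinear_map (@act_word k H V ^~ h).
Proof.
move=> u v a x y; elim: u h => [|z u IH] h.
  have L : lin (fun x => act_word (x :: v) h) by have lv := lin_act_word v; rewrite /=; islin.
  exact: L.
rewrite /= -tlift_lincomb; apply: eq_tlift => h1 h2.
by rewrite IH (tmul_bilinear V).2.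
Qed.

Lemma tact_bilinear : bilinear_map (@tact k H V).
Proof.
apply: bilP => [t|h]; last exact: lin_wlift (act_word_multilinear h).
move=> a x y; rewrite -wlift_lincomb; congr (wlift _ _); apply/funext => w.
exact: lin_act_word.
Qed.
Hint Extern 0 (bilinear_map _) => exact: tact_bilinear : bilin.

Lemma tact_tone h : tact h (tone V) = ε h *: tone V.
Proof. by rewrite /tact wliftE //; exact: act_word_multilinear. Qed.

(** [tact_cons], [tcoact_cons] and [tcomul_cons] are the recursions behind all the
    inductions on words below. *)
Lemma tact_cons h x (t : T) :
  tact h (ι x ∗ t) = \sw_(h1, h2 <- Δ h) (ι (act h1 x) ∗ tact h2 t).
Proof.
move: t; apply: talg_eq => [||w]; try by islin.
rewrite tmul_word /tact wliftE /=; last exact: act_word_multilinear.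
by apply: eq_tlift => h1 h2; rewrite wliftE //; exact: act_word_multilinear.
Qed.

Lemma tactM h (s t : T) :
  tact h (s ∗ t) = \sw_(h1, h2 <- Δ h) (tact h1 s ∗ tact h2 t).
Proof.
move: s; apply: talg_eq => [||w]; try by islin.
elim: w h => [|x w IH] h.
  rewrite tmul1l; under eq_tlift => h1 h2 do
    rewrite tact_tone (linZ _ _ (bil_l _ (tmul_bilinear V))) tmul1l.
  by rewrite counitlE //; islin.
rewrite word_cons -tmulA tact_cons.
under eq_tlift => h1 h2 do rewrite IH (tlift_map _ _ (bil_r _ (tmul_bilinear V))).
rewrite -(coassoc (F := fun h1 h2 h3 => ι (act h1 x) ∗ (tact h2 (word w) ∗ tact h3 t))); try by islin.
apply: eq_tlift => h1 h2; rewrite tact_cons (tlift_map _ _ (bil_l _ (tmul_bilinear V))).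
by apply: eq_tlift => h11 h12; rewrite tmulA.
Qed.

Lemma tact_mul g h (t : T) : tact (g * h) t = tact g (tact h t).
Proof.
move: t; apply: talg_eq => [||w]; try by islin.
elim: w g h => [|x w IH] g h.
  by rewrite !tact_tone (linZ _ _ (bil_r _ tact_bilinear)) tact_tone scalerA counitM mulrC.
rewrite word_cons !tact_cons (tlift_map _ _ (bil_r _ tact_bilinear)) comulME; last by islin.
rewrite tlift_exchange; apply: eq_tlift => h1 h2; rewrite tact_cons.
by apply: eq_tlift => g1 g2; rewrite actM IH.
Qed.

Lemma tact_one (t : T) : tact 1 t = t.
Proof.
move: t; apply: talg_eq => [||w]; try by islin.
elim: w => [|x w IH]; first by rewrite tact_tone counit1 scale1r.
by rewrite word_cons tact_cons comul1 tliftE ?act1 ?IH //; islin.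
Qed.

Lemma coact_word_multilinear : multilinear_map (@coact_word k H V).
Proof.
move=> u v a x y; elim: u => [|z u IH].
  have L : lin (fun x => coact_word (x :: v)) by rewrite /=; islin.
  exact: L.
rewrite /= -tlift_lincomb; apply: eq_tlift => h1 h2.
by rewrite IH lin_tlift //; islin.
Qed.

Lemma lin_tcoact : lin (@tcoact k H V).
Proof. exact: lin_wlift coact_word_multilinear. Qed.
Hint Extern 0 (lin _) => exact: lin_tcoact : bilin.

Lemma tcoact_tone : tcoact (tone V) = 1 ⊗ tone V.
Proof. by rewrite /tcoact wliftE //; exact: coact_word_multilinear. Qed.

Lemma tcoact_cons x (t : T) :
  tcoact (ι x ∗ t)
  = \sw_(g, x0 <- δ x) \sw_(g', t0 <- tcoact t) (g * g') ⊗ (ι x0 ∗ t0).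
Proof.
move: t; apply: talg_eq => [||w]; try by islin.
by rewrite tmul_word /tcoact !wliftE //=; exact: coact_word_multilinear.
Qed.

Lemma tcoact_consE (U : lmodType k) (F : H -> T -> U) x t : bilinear_map F ->
  tlift F (tcoact (ι x ∗ t))
  = \sw_(g, x0 <- δ x) \sw_(g', t0 <- tcoact t) F (g * g') (ι x0 ∗ t0).
Proof.
move=> Fl; rewrite tcoact_cons (tlift_map _ _ (lin_tlift Fl)); apply: eq_tlift => g x0.
by rewrite (tlift_map _ _ (lin_tlift Fl)); apply: eq_tlift => g' t0; rewrite tliftE.
Qed.

Lemma coact_coassoc (U : lmodType k) (F : H -> H -> V -> U) x :
  (forall h v, lin (fun g => F g h v)) -> (forall g v, lin (fun h => F g h v)) ->
  (forall g h, lin (F g h)) ->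
  \sw_(g, x0 <- δ x) \sw_(g1, g2 <- Δ g) F g1 g2 x0
  = \sw_(g, x0 <- δ x) \sw_(g', x00 <- δ x0) F g g' x00.
Proof.
move=> F1 F2 F3.
have G g : bilinear_map (F g) by apply: bilP => y; [exact: F2 | exact: F3].
have G' : lin (tlift (fun g => tlift (F g))).
  by apply: lin_tlift; apply: bilP => y; [apply: lin_sw => v w; exact: F1 | exact: lin_tlift].
have G'' : bilinear_map (fun g => tlift (F g)).
  by apply: bilP => y; [apply: lin_sw => v w; exact: F1 | exact: lin_tlift].
have := congr1 (tlift (fun g => tlift (F g))) (coactA x).
rewrite !(tlift_map _ _ G').
under eq_tlift => g x0 do rewrite (tlift_map _ _ G').
under [X in _ = X -> _]eq_tlift => g x0 do rewrite (tlift_map _ _ G').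
move=> E; etransitivity; last (etransitivity; first exact: E).
  by apply: eq_tlift => g x0; apply: eq_tlift => g1 g2; rewrite !tliftE.
by apply: eq_tlift => g x0; apply: eq_tlift => g1 g2; rewrite !tliftE.
Qed.

Lemma coact_counit (U : lmodType k) (F : V -> U) x : lin F ->
  \sw_(g, x0 <- δ x) ε g *: F x0 = F x.
Proof.
move=> Fl; rewrite -[in RHS](coact1 x) (tlift_map _ _ Fl).
by apply: eq_tlift => g x0; rewrite linZ.
Qed.

Lemma tcoactM (U : lmodType k) (F : H -> T -> U) s t : bilinear_map F ->
  tlift F (tcoact (s ∗ t))
  = \sw_(g, s0 <- tcoact s) \sw_(g', t0 <- tcoact t) F (g * g') (s0 ∗ t0).
Proof.
move=> Fl; move: s; apply: talg_eq => [||w]; try by islin.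
elim: w U F Fl => [|x w IH] U F Fl.
  rewrite tmul1l tcoact_tone tliftE; last by islin.
  by apply: eq_tlift => g t0; rewrite mul1r tmul1l.
rewrite word_cons -tmulA !tcoact_consE; try by islin.
apply: eq_tlift => g x0; rewrite (IH _ (fun g' w0 => F (g * g') (ι x0 ∗ w0))); last by islin.
by apply: eq_tlift => g' w0; apply: eq_tlift => g'' t0; rewrite mulrA tmulA.
Qed.

Lemma tcoact_coassoc (U : lmodType k) (F : H -> H -> T -> U) t :
  (forall h v, lin (fun g => F g h v)) -> (forall g v, lin (fun h => F g h v)) ->
  (forall g h, lin (F g h)) ->
  \sw_(g, t0 <- tcoact t) \sw_(g1, g2 <- Δ g) F g1 g2 t0
  = \sw_(g, t0 <- tcoact t) \sw_(g', t00 <- tcoact t0) F g g' t00.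
Proof.
suff E : forall w (F1 : H -> H -> T -> U),
  (forall h v, lin (fun g => F1 g h v)) -> (forall g v, lin (fun h => F1 g h v)) ->
  (forall g h, lin (F1 g h)) ->
  \sw_(g, t0 <- tcoact (word w)) \sw_(g1, g2 <- Δ g) F1 g1 g2 t0
  = \sw_(g, t0 <- tcoact (word w)) \sw_(g', t00 <- tcoact t0) F1 g g' t00 :> U.
  move=> F1 F2 F3; move: t; apply: talg_eq => [||w]; try by islin.
  exact: E.
move=> {F t}; elim=> [|x w IH] F' F1 F2 F3.
  by rewrite tcoact_tone !tliftE ?comul1 ?tcoact_tone ?tliftE; islin.
rewrite word_cons !tcoact_consE; try by islin.
transitivity (\sw_(g, x0 <- δ x) \sw_(g1, g2 <- Δ g)
  \sw_(g', w0 <- tcoact (word w)) \sw_(g'1, g'2 <- Δ g') F' (g1 * g'1) (g2 * g'2) (ι x0 ∗ w0)).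
  apply: eq_tlift => g x0; rewrite [RHS]tlift_exchange; apply: eq_tlift => g' w0.
  by rewrite comulME //; islin.
rewrite (coact_coassoc (F := fun g1 g2 x0 => \sw_(g', w0 <- tcoact (word w))
  \sw_(g'1, g'2 <- Δ g') F' (g1 * g'1) (g2 * g'2) (ι x0 ∗ w0))); try by islin.
apply: eq_tlift => g x0.
transitivity (\sw_(g2, x00 <- δ x0) \sw_(g', w0 <- tcoact (word w)) \sw_(g'', w00 <- tcoact w0)
  F' (g * g') (g2 * g'') (ι x00 ∗ w00)).
  apply: eq_tlift => g2 x00.
  by rewrite (IH (fun g'1 g'2 w0 => F' (g * g'1) (g2 * g'2) (ι x00 ∗ w0))) //; islin.
rewrite tlift_exchange; apply: eq_tlift => g' w0.
by rewrite tcoact_consE //; islin.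
Qed.

Lemma tcoact_counit (U : lmodType k) (F : T -> U) t : lin F ->
  \sw_(g, t0 <- tcoact t) ε g *: F t0 = F t.
Proof.
move=> Fl; move: t; apply: talg_eq => [||w]; try by islin.
elim: w F Fl => [|x w IH] F Fl.
  by rewrite tcoact_tone tliftE ?counit1 ?scale1r //; islin.
rewrite word_cons tcoact_consE; last by islin.
under eq_tlift => g x0.
  under eq_tlift => g' w0 do rewrite counitM -scalerA.
  rewrite tliftZ (IH (fun w0 => F (ι x0 ∗ w0))); last by islin.
  over.
by rewrite (coact_counit (F := fun x0 => F (ι x0 ∗ word w))) //; islin.
Qed.

(** The Yetter-Drinfeld condition with the antipode moved to the other side. In this
    form it involves only products, and so passes from V to words in V. *)
Lemma act_coact (U : lmodType k) (F : H -> V -> U) h x : bilinear_map F ->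
  \sw_(h1, h2 <- Δ h) \sw_(g, x0 <- δ (act h1 x)) F (g * h2) x0
  = \sw_(h1, h2 <- Δ h) \sw_(g, x0 <- δ x) F (h1 * g) (act h2 x0).
Proof.
move=> Fl.
pose G a b c d := \sw_(g, x0 <- δ x) F (a * g * (S c * d)) (act b x0).
transitivity (\sw_(h1, h2 <- Δ h) \sw_(h11, h12 <- Δ h1) \sw_(h121, h122 <- Δ h12)
  G h11 h121 h122 h2).
  apply: eq_tlift => h1 h2; rewrite coact_act.
  have L : lin (tlift (fun g x0 => F (g * h2) x0)) by islin.
  rewrite (tlift_map _ _ L); apply: eq_tlift => h11 h12.
  rewrite (tlift_map _ _ L); apply: eq_tlift => h121 h122.
  rewrite (tlift_map _ _ L); apply: eq_tlift => g x0.
  by rewrite tliftE ?mulrA //; islin.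
rewrite (coassoc (F := fun a b c => \sw_(b1, b2 <- Δ b) G a b1 b2 c)); try by rewrite /G; islin.
apply: eq_tlift => h1 h2.
rewrite (coassoc (F := fun b c d => G h1 b c d)); try by rewrite /G; islin.
under eq_tlift => h21 h22.
  rewrite /G tlift_exchange.
  under eq_tlift => g x0.
    rewrite (antiplE (F := fun y => F (h1 * g * y) (act h21 x0))); last by islin.
    rewrite mulr1; over.
  rewrite tliftZ; over.
by rewrite (counitrE (F := fun h21 => \sw_(g, x0 <- δ x) F (h1 * g) (act h21 x0))) //; islin.
Qed.

(** Induction on words, writing h . (x w) as (h_1 . x) (h_2 . w): the factor h_3 on the
    right is first moved past the coaction of h_2 . w, by the induction hypothesis,
    and then past that of h_1 . x, by [act_coact]. *)
Lemma tact_tcoact (U : lmodType k) (F : H -> T -> U) h t : bilinear_map F ->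
  \sw_(h1, h2 <- Δ h) \sw_(g, t0 <- tcoact (tact h1 t)) F (g * h2) t0
  = \sw_(h1, h2 <- Δ h) \sw_(g, t0 <- tcoact t) F (h1 * g) (tact h2 t0).
Proof.
move=> Fl; move: t; apply: talg_eq => [||w]; try by islin.
elim: w h F Fl => [|x w IH] h F Fl.
  under eq_tlift => h1 h2.
    rewrite tact_tone (linZ _ _ lin_tcoact) linZ; last by islin.
    rewrite tcoact_tone tliftE; last by islin.
    rewrite mul1r; over.
  rewrite (counitlE (F := fun h2 => F h2 (tone V))); last by islin.
  under eq_tlift => h1 h2.
    rewrite tcoact_tone tliftE; last by islin.
    rewrite tact_tone mulr1 linZ; last by islin.
    over.
  by rewrite (counitrE (F := fun h1 => F h1 (tone V))) //; islin.
rewrite word_cons.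
under eq_tlift => h1 h2.
  have L : lin (fun s => \sw_(g, t0 <- tcoact s) F (g * h2) t0) by islin.
  rewrite tact_cons (tlift_map _ _ L).
  under eq_tlift => h11 h12 do [rewrite tcoact_consE; last by islin].
  over.
rewrite /= (coassoc (F := fun h1 h2 h3 => \sw_(g, x0 <- δ (act h1 x))
  \sw_(g', w0 <- tcoact (tact h2 (word w))) F (g * g' * h3) (ι x0 ∗ w0))); try by islin.
transitivity (\sw_(h1, h2 <- Δ h) \sw_(h21, h22 <- Δ h2) \sw_(g, x0 <- δ (act h1 x))
  \sw_(g', w0 <- tcoact (word w)) F (g * h21 * g') (ι x0 ∗ tact h22 w0)).
  apply: eq_tlift => h1 h2; rewrite tlift_exchange [RHS]tlift_exchange.
  apply: eq_tlift => g x0.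
  under eq_tlift => h21 h22 do under eq_tlift => g' w0 do rewrite -mulrA.
  rewrite (IH h2 (fun y w0 => F (g * y) (ι x0 ∗ w0))); last by islin.
  by apply: eq_tlift => h21 h22; apply: eq_tlift => g' w0; rewrite mulrA.
rewrite -(coassoc (F := fun h1 h2 h3 => \sw_(g, x0 <- δ (act h1 x))
  \sw_(g', w0 <- tcoact (word w)) F (g * h2 * g') (ι x0 ∗ tact h3 w0))); try by islin.
transitivity (\sw_(h1, h2 <- Δ h) \sw_(h11, h12 <- Δ h1) \sw_(g, x0 <- δ x)
  \sw_(g', w0 <- tcoact (word w)) F (h11 * g * g') (ι (act h12 x0) ∗ tact h2 w0)).
  apply: eq_tlift => h1 h2.
  by rewrite (act_coact (F := fun y x0 => \sw_(g', w0 <- tcoact (word w))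
    F (y * g') (ι x0 ∗ tact h2 w0))) //; islin.
rewrite (coassoc (F := fun h1 h2 h3 => \sw_(g, x0 <- δ x)
  \sw_(g', w0 <- tcoact (word w)) F (h1 * g * g') (ι (act h2 x0) ∗ tact h3 w0))); try by islin.
apply: eq_tlift => h1 h2; rewrite tcoact_consE; last by islin.
rewrite tlift_exchange; apply: eq_tlift => g x0.
rewrite tlift_exchange; apply: eq_tlift => g' w0.
rewrite tact_cons tlift_map; last by islin.
by apply: eq_tlift => h21 h22; rewrite mulrA.
Qed.

(** The braided product with a primitive letter on the left:
    (x ⊗ 1 + 1 ⊗ x) (c ⊗ d) = x c ⊗ d + (x_(-1) . c) ⊗ x_(0) d. *)
Definition tcomul_letter (x : V) (t : T ⊗ T) : T ⊗ T :=
  \sw_(c, d <- t) ((ι x ∗ c) ⊗ d + \sw_(g, x0 <- δ x) tact g c ⊗ (ι x0 ∗ d)).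

Lemma tcomul_letter_bilinear : bilinear_map tcomul_letter.
Proof. by rewrite /tcomul_letter; islin. Qed.
Hint Extern 0 (bilinear_map _) => exact: tcomul_letter_bilinear : bilin.

Lemma braided_mul_letter x t :
  braided_mul (ι x ⊗ tone V + tone V ⊗ ι x) t = tcomul_letter x t.
Proof.
have L : lin (fun s => braided_mul s t) by rewrite /braided_mul; islin.
rewrite (linD _ _ L) /braided_mul !tliftE; try by islin.
have -> : \sw_(c, d <- t) \sw_(g, b0 <- tcoact (tone V)) ((ι x ∗ tact g c) ⊗ (b0 ∗ d))
  = \sw_(c, d <- t) ((ι x ∗ c) ⊗ d).
  by apply: eq_tlift => c d; rewrite tcoact_tone tliftE ?tact_one ?tmul1l //; islin.
rewrite -tliftD; apply: eq_tlift => c d; congr (_ + _).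
rewrite -[word [:: x]]tmul1r tcoact_consE; last by islin.
by apply: eq_tlift => g x0; rewrite tcoact_tone tliftE ?mulr1 ?tmul1l ?tmul1r //; islin.
Qed.

Lemma comul_word_multilinear : multilinear_map (@comul_word k H V).
Proof.
move=> u v a x y; elim: u => [|z u IH] /=; rewrite !braided_mul_letter.
  exact: tcomul_letter_bilinear.1.
by rewrite IH tcomul_letter_bilinear.2.
Qed.

Lemma lin_tcomul : lin (@tcomul k H V).
Proof. exact: lin_wlift comul_word_multilinear. Qed.
Hint Extern 0 (lin _) => exact: lin_tcomul : bilin.

Lemma tcomul_tone : tcomul (tone V) = tone V ⊗ tone V.
Proof. by rewrite /tcomul wliftE //; exact: comul_word_multilinear. Qed.

Lemma tcomul_cons x (t : T) : tcomul (ι x ∗ t) = tcomul_letter x (tcomul t).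
Proof.
move: t; apply: talg_eq => [||w]; try by islin.
rewrite tmul_word /tcomul !wliftE /= ?braided_mul_letter //; exact: comul_word_multilinear.
Qed.

Lemma tlift_tcomul_letter (U : lmodType k) (F : T -> T -> U) x t : bilinear_map F ->
  tlift F (tcomul_letter x t)
  = \sw_(c, d <- t) (F (ι x ∗ c) d + \sw_(g, x0 <- δ x) F (tact g c) (ι x0 ∗ d)).
Proof.
move=> Fl; rewrite (tlift_map _ _ (lin_tlift Fl)); apply: eq_tlift => c d.
rewrite (linD _ _ (lin_tlift Fl)) (tliftE Fl) (tlift_map _ _ (lin_tlift Fl)); congr (_ + _).
by apply: eq_tlift => g x0; rewrite (tliftE Fl).
Qed.

(** The coproduct of T(V) is H-linear because the braiding is, which for the braiding
    with a letter is [act_coact]. *)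
Lemma tcomul_tact h (t : T) :
  tcomul (tact h t) = \sw_(h1, h2 <- Δ h) \sw_(a, b <- tcomul t) tact h1 a ⊗ tact h2 b.
Proof.
move: t; apply: talg_eq => [||w]; try by islin.
elim: w h => [|x w IH] h.
  rewrite tact_tone (linZ _ _ lin_tcomul) tcomul_tone.
  under eq_tlift => h1 h2.
    rewrite tliftE; last by islin.
    rewrite !tact_tone (linZ _ _ (bil_l _ (tens_bilinear T T))) (linZ _ _ (bil_r _ (tens_bilinear T T))).
    over.
  by rewrite (counitlE (F := fun h => ε h *: (tone V ⊗ tone V))) //; islin.
rewrite word_cons tact_cons (tlift_map _ _ lin_tcomul).
under eq_tlift => h1 h2.
  rewrite tcomul_cons IH (tlift_map _ _ (bil_r _ tcomul_letter_bilinear)).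
  under eq_tlift => h21 h22.
    rewrite (tlift_map _ _ (bil_r _ tcomul_letter_bilinear)).
    under eq_tlift => c d.
      rewrite /tcomul_letter tliftE; last by islin.
      over.
    over.
  over.
rewrite /= -(coassoc (F := fun h1 h2 h3 => \sw_(c, d <- tcomul (word w))
  (tens (ι (act h1 x) ∗ tact h2 c) (tact h3 d)
   + \sw_(g, x0 <- δ (act h1 x)) tact g (tact h2 c) ⊗ (ι x0 ∗ tact h3 d)))); try by islin.
rewrite tcomul_cons.
transitivity (\sw_(h1, h2 <- Δ h) \sw_(c, d <- tcomul (word w))
  (\sw_(h11, h12 <- Δ h1) (ι (act h11 x) ∗ tact h12 c) ⊗ tact h2 d
   + \sw_(h11, h12 <- Δ h1) \sw_(g, x0 <- δ x) tact h11 (tact g c) ⊗ (ι (act h12 x0) ∗ tact h2 d))).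
  apply: eq_tlift => h1 h2; rewrite tlift_exchange; apply: eq_tlift => c d.
  rewrite tliftD; congr (_ + _).
  transitivity (\sw_(h11, h12 <- Δ h1) \sw_(g, x0 <- δ (act h11 x))
     tact (g * h12) c ⊗ (ι x0 ∗ tact h2 d)).
    by apply: eq_tlift => h11 h12; apply: eq_tlift => g x0; rewrite tact_mul.
  rewrite (act_coact (F := fun y x0 => tact y c ⊗ (ι x0 ∗ tact h2 d))); last by islin.
  by apply: eq_tlift => h11 h12; apply: eq_tlift => g x0; rewrite tact_mul.
under [RHS]eq_tlift => h1 h2 do [rewrite tlift_tcomul_letter; last (by islin); rewrite tliftD].
under eq_tlift => h1 h2 do rewrite tliftD.
rewrite !tliftD; congr (_ + _).
  apply: eq_tlift => h1 h2; apply: eq_tlift => c d.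
  by rewrite tact_cons (tlift_map _ _ (bil_l _ (tens_bilinear T T))).
under eq_tlift => h1 h2 do rewrite tlift_exchange.
rewrite (coassoc (F := fun h1 h2 h3 => \sw_(c, d <- tcomul (word w)) \sw_(g, x0 <- δ x)
  tact h1 (tact g c) ⊗ (ι (act h2 x0) ∗ tact h3 d))); try by islin.
apply: eq_tlift => h1 h2; rewrite tlift_exchange; apply: eq_tlift => c d.
rewrite tlift_exchange; apply: eq_tlift => g x0.
by rewrite tact_cons (tlift_map _ _ (bil_r _ (tens_bilinear T T))).
Qed.

(** The coproduct of T(V) is H-colinear. Moving the coaction past the letter that
    acts on c uses the Yetter-Drinfeld condition on all of T(V). *)
Lemma tcoact_tcomul (U : lmodType k) (F : H -> T ⊗ T -> U) t : bilinear_map F ->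
  \sw_(g, t0 <- tcoact t) F g (tcomul t0)
  = \sw_(a, b <- tcomul t) \sw_(g, a0 <- tcoact a) \sw_(g', b0 <- tcoact b)
      F (g * g') (a0 ⊗ b0).
Proof.
move=> Fl; move: t; apply: talg_eq => [||w]; try by islin.
elim: w F Fl => [|x w IH] F Fl.
  rewrite tcomul_tone !tcoact_tone !tliftE; try by islin.
  by rewrite tcoact_tone tliftE ?tliftE ?mulr1 ?tcomul_tone //; islin.
rewrite word_cons tcoact_consE; last by islin.
under eq_tlift => g x0.
  under eq_tlift => g' w0 do rewrite tcomul_cons.
  rewrite (IH (fun g' s => F (g * g') (tcomul_letter x0 s))); last by islin.
  over.
rewrite tcomul_cons tlift_tcomul_letter; last by islin.
rewrite tlift_exchange; apply: eq_tlift => a b.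
transitivity (\sw_(g, x0 <- δ x) ((\sw_(g', a0 <- tcoact a) \sw_(g'', b0 <- tcoact b)
      F (g * g' * g'') ((ι x0 ∗ a0) ⊗ b0))
  + \sw_(g3, x00 <- δ x0) \sw_(g', a0 <- tcoact a) \sw_(g'', b0 <- tcoact b)
      F (g * g' * g'') (tact g3 a0 ⊗ (ι x00 ∗ b0)))).
  apply: eq_tlift => g x0.
  rewrite [X in _ + X]tlift_exchange -tliftD; apply: eq_tlift => g' a0.
  rewrite [X in _ + X]tlift_exchange -tliftD; apply: eq_tlift => g'' b0.
  rewrite /tcomul_letter tliftE; last by islin.
  rewrite (linD _ _ (bil_r _ Fl)) (tlift_map _ _ (bil_r _ Fl)) mulrA //.
rewrite tliftD; congr (_ + _).
  by rewrite tcoact_consE //; islin.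
rewrite -(coact_coassoc (F := fun g g3 x0 => \sw_(g', a0 <- tcoact a) \sw_(g'', b0 <- tcoact b)
      F (g * g' * g'') (tact g3 a0 ⊗ (ι x0 ∗ b0)))); try by islin.
under [RHS]eq_tlift => g x0.
  under eq_tlift => p q do [rewrite tcoact_consE; last by islin].
  rewrite tlift_exchange; over.
rewrite /= -(coact_coassoc (F := fun g g2 x0 =>
      \sw_(p, q <- tcoact (tact g a)) \sw_(g'', b0 <- tcoact b)
      F (p * (g2 * g'')) (q ⊗ (ι x0 ∗ b0)))); try by islin.
apply: eq_tlift => g x0.
rewrite -(tact_tcoact (F := fun p q => \sw_(g'', b0 <- tcoact b)
      F (p * g'') (q ⊗ (ι x0 ∗ b0)))); last by islin.
apply: eq_tlift => g1 g2; apply: eq_tlift => p q; apply: eq_tlift => g'' b0.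
by rewrite mulrA.
Qed.

End YD.
#[export] Hint Extern 0 (bilinear_map _) => exact: tact_bilinear : bilin.
#[export] Hint Extern 0 (lin _) => exact: lin_tcoact : bilin.
#[export] Hint Extern 0 (lin _) => exact: lin_tcomul : bilin.
Arguments lin_tcoact {k H V}.
Arguments lin_tcomul {k H V}.

(** * Functionals separate tensors *)

Section Span.
Variable k : fieldType.
Implicit Types V W U : lmodType k.

Lemma span_lin V U (S : V -> Prop) (S' : U -> Prop) (f : V -> U) t :
  lin f -> (forall s, S s -> Defs.span S' (f s)) -> Defs.span S t -> Defs.span S' (f t).
Proof.
move=> fl fS; elim=> [|a s v Ss _ IH]; first by rewrite (lin0 fl); constructor.
by rewrite fl; apply: spanD => //; apply: spanZ; apply: fS.
Qed.

Lemma span_sub V (S S' : V -> Prop) t :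
  (forall s, S s -> Defs.span S' s) -> Defs.span S t -> Defs.span S' t.
Proof. by apply: (span_lin (f := fun x => x)); exact: lin_id. Qed.

(** By Zorn's lemma there is a subspace N that contains W and is maximal among those
    avoiding x. It is a hyperplane complementary to the line of x, and f is the
    coordinate along x. *)
Lemma span_functional V (W : V -> Prop) x : ~ Defs.span W x ->
  exists f : V -> k^o, [/\ lin f, f x = 1 & forall w, W w -> f w = 0].
Proof.
move=> xW.
(* Arbitrary sets M are used instead of subspaces, so that the union of a chain, and
   even of the empty chain, is again a candidate. *)
pose P (M : set V) := ~ Defs.span (fun v => W v \/ M v) x.
have [F FP Ft|M [MP Mmax]] := @Zorn_bigcup _ (P : set (set V)).
  suff H y : Defs.span (fun v => W v \/ (\bigcup_(X in F) X)%classic v) y ->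
      Defs.span W y \/ exists2 X, F X & Defs.span (fun v => W v \/ X v) y.
    by move=> /H[//|[X FX]]; exact: FP FX.
  elim=> [|a s w Ss _ IH]; first by left; constructor.
  have WX X u : Defs.span W u -> Defs.span (fun v => W v \/ X v) u.
    by apply: span_sub => v Wv; apply: span_gen; left.
  case: Ss => [Ws|[X FX Xs]].
    case: IH => [IH|[X FX IH]]; first by left; apply: Defs.span_cons.
    by right; exists X => //; apply: Defs.span_cons => //; left.
  right; case: IH => [IH|[Y FY IH]].
    by exists X => //; apply: Defs.span_cons; [right | exact: WX].
  case: (Ft X Y FX FY) => XY.
    by exists Y => //; apply: Defs.span_cons => //; right; apply: XY.
  exists X => //; apply: Defs.span_cons; first by right.
  apply: span_sub IH => v [Wv|Yv]; apply: span_gen; first by left.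
  by right; apply: XY.
pose N := Defs.span (fun v => W v \/ M v).
have xN y : exists c, N (y - c *: x).
  have [Ny|nNy] := pselect (N y); first by exists 0; rewrite scale0r subr0.
  have : ~ P (M `|` [set y])%classic.
    apply: Mmax; split; first by left.
    by move=> /(_ y (or_intror erefl)) My; apply: nNy; apply: span_gen; right.
  move=> /contrapT Hx.
  have [b [m [Nm xE]]] : exists b m, N m /\ x = b *: y + m.
    elim: Hx => [|a s v Ss _ [b [m [Nm ->]]]].
      by exists 0, 0; split; [constructor | rewrite scale0r addr0].
    case: Ss => [Ws|[Ms| -> ]].
    - by exists b, (a *: s + m); split; [apply: Defs.span_cons => //; left|rewrite addrCA].
    - by exists b, (a *: s + m); split; [apply: Defs.span_cons => //; right|rewrite addrCA].
    - by exists (a + b), m; split => //; rewrite scalerDl addrA.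
  have [b0|b0] := eqVneq b 0.
    by case: MP; move: Nm; rewrite xE b0 scale0r add0r.
  exists b^-1; rewrite xE scalerDr scalerA mulVf // scale1r opprD addNKr.
  by apply: spanN; apply: spanZ.
have uniq c : N (c *: x) -> c = 0.
  have [-> //|c0] := eqVneq c 0.
  by move=> /(spanZ c^-1); rewrite scalerA mulVf // scale1r => /MP.
have fN y c : N (y - c *: x) -> sval (cid (xN y)) = c.
  case: cid => d /= Nd Nc; apply/eqP; rewrite -subr_eq0; apply/eqP/uniq.
  have := spanD Nc (spanN Nd); rewrite opprB addrC addrA subrK.
  by rewrite scalerBl.
exists (fun y => sval (cid (xN y))); split.
- move=> a y z; apply: fN; case: cid => c /= Nc; case: cid => d /= Nd.
  rewrite scalerDl opprD addrACA -scalerA -scalerBr.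
  by apply: spanD => //; apply: spanZ.
- by apply: fN; rewrite scale1r subrr; constructor.
- by move=> w Ww; apply: fN; rewrite scale0r subr0; apply: span_gen; left.
Qed.

Let tsum V W (s : seq (V * W)) : V ⊗ W := \sum_(p <- s) p.1 ⊗ p.2.

Lemma tensor_sum V W (t : V ⊗ W) : exists s, t = tsum s.
Proof.
elim: (tensor_span t) => [|a r u [v [w ->]] _ [s ->]].
  by exists [::]; rewrite /tsum big_nil.
exists ((v, a *: w) :: s); rewrite /tsum big_cons; congr (_ + _) => /=.
by rewrite (linZ _ _ (bil_r _ (tens_bilinear V W))).
Qed.

(** Expand v in the first factors and move the coefficients to the second ones. *)
Lemma tsum_absorb V W (s : seq (V * W)) v w :
  Defs.span (fun x => exists2 p, p \in s & x = p.1) v ->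
  exists s', size s' = size s /\ v ⊗ w + tsum s = tsum s'.
Proof.
move=> H; suff [s' [s1 _ E]] : exists s', [/\ size s' = size s, map fst s' = map fst s
    & v ⊗ w + tsum s = tsum s'] by exists s'.
elim: H => [|a x u [p ps ->] _ [s' [ss' ms' E]]].
  exists s; split=> //.
  by rewrite (lin0 (bil_l _ (tens_bilinear V W))) add0r.
rewrite tensDl -addrA E.
have : p.1 \in map fst s' by rewrite ms'; exact: map_f.
case/mapP => -[p1 q] /= qs' pE; rewrite pE => {p pE ps}.
case/splitPr: qs' ss' ms' E => l r ss' ms' E.
exists (l ++ (p1, a *: w + q) :: r); split.
- by rewrite -ss' !size_cat.
- by rewrite -ms' !map_cat.
rewrite /tsum !big_cat !big_cons /= addrCA; congr (_ + _).
by rewrite addrA tensDr.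
Qed.

(** Induction on the length of an expression of the tensor as a sum of v ⊗ w. If the
    first v depends linearly on the others, the sum can be shortened; if not, a
    functional equal to 1 on v and to 0 on the others shows that w = 0. *)
Lemma tensor_eq0 V W (t : V ⊗ W) :
  (forall f : V -> k^o, lin f -> \sw_(v, w <- t) f v *: w = 0) -> t = 0.
Proof.
have [s ->] := tensor_sum t; move: {2}(size s) (erefl (size s)) => n.
elim: n s => [|n IH] [|[v w] s] //=; first by rewrite /tsum big_nil.
case=> sn; rewrite /tsum big_cons -/(tsum s) /= => fs.
have [vs|vs] := pselect (Defs.span (fun x => exists2 p, p \in s & x = p.1) v).
  have [s' [ss' E]] := tsum_absorb w vs.
  by rewrite E; apply: IH; [rewrite ss' | rewrite -E].
have [f [fl fv fw]] := span_functional vs.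
have L : lin (tlift (fun v w => f v *: w : W)) by islin.
have fs0 : \sw_(v, w <- tsum s) f v *: w = 0.
  rewrite /tsum; elim: (s) fw => [|p r IHr] fw; first by rewrite big_nil (lin0 L).
  rewrite big_cons (linD _ _ L) tliftE ?fw ?scale0r ?add0r ?IHr //; last by islin.
  - by move=> x [q qr xE]; apply: fw; exists q => //; rewrite inE qr orbT.
  - by exists p => //; rewrite mem_head.
have w0 : w = 0.
  by have := fs f fl; rewrite (linD _ _ L) fs0 addr0 tliftE ?fv ?scale1r //; islin.
rewrite w0 (lin0 (bil_r _ (tens_bilinear V W))) add0r; apply: IH => // g gl.
have := fs g gl; rewrite w0 (lin0 (bil_r _ (tens_bilinear V W))) add0r //.
Qed.

End Span.

(** * Admissible ideals and Yetter-Drinfeld stability *)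

Section Homogeneous.
Variables (k : fieldType) (V : lmodType k).
Local Notation "s ∗ t" := (tmul s t) (at level 40, left associativity).

Lemma thomog_mul m n (s t : talg V) : thomog m s -> thomog n t -> thomog (m + n) (s ∗ t).
Proof.
move=> Hs Ht; move: Hs; apply: (span_lin (f := fun s => s ∗ t)); first by islin.
move=> _ [u <- ->]; move: Ht; apply: span_lin; first by islin.
by move=> _ [v <- ->]; apply: span_gen; exists (u ++ v); rewrite ?size_cat // tmul_word.
Qed.

Lemma thomog_word (w : seq V) : thomog (size w) (word w).
Proof. by apply: span_gen; exists w. Qed.

End Homogeneous.

Section Admissible.
Variables (k : fieldType) (H : hopfAlg k) (V : ydMod H).
Local Notation T := (talg V).
Local Notation Δ := (comul H).
Local Notation ε := (counit H).
Local Notation S := (antip H).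
Local Notation δ := (coact V).
Local Notation "s ∗ t" := (tmul s t) (at level 40, left associativity).
Local Notation ι x := (word [:: x]).

Lemma thomog_tact n h (t : T) : thomog n t -> thomog n (tact h t).
Proof.
apply: span_lin; first by islin.
move=> _ [w <- ->]; elim: w h => [|x w IH] h.
  by rewrite tact_tone; apply: spanZ; exact: thomog_word.
rewrite word_cons tact_cons; apply: span_tlift => h1 h2.
by rewrite -[size _]/(1 + size w)%N; apply: thomog_mul; [exact: (thomog_word [:: _]) | exact: IH].
Qed.

(** The coaction of H seen as an action of the dual of H. It turns stability under the
    coaction into stability under a family of endomorphisms of T(V). *)
Definition hit (f : H -> k^o) (t : T) : T := \sw_(g, t0 <- tcoact t) f g *: t0.

Lemma lin_hit f : lin f -> lin (hit f).
Proof. by move=> fl; rewrite /hit; islin. Qed.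

Lemma thomog_hit n f (t : T) : lin f -> thomog n t -> thomog n (hit f t).
Proof.
move=> fl; apply: span_lin; first exact: lin_hit.
move=> _ [w <- ->]; elim: w f fl => [|x w IH] f fl.
  by rewrite /hit tcoact_tone tliftE; [apply: spanZ; exact: thomog_word | islin].
rewrite /hit word_cons tcoact_consE; last by islin.
apply: span_tlift => g x0.
suff -> : \sw_(g', t0 <- tcoact (word w)) f (g * g') *: (ι x0 ∗ t0)
    = ι x0 ∗ hit (fun g' => f (g * g')) (word w).
  rewrite -[size _]/(1 + size w)%N; apply: thomog_mul; first exact: (thomog_word [:: _]).
  by apply: IH; islin.
rewrite /hit (tlift_map _ _ (bil_r _ (tmul_bilinear V))); apply: eq_tlift => g' t0.
by rewrite (linZ _ _ (bil_r _ (tmul_bilinear V))).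
Qed.

Section Ideal.
Variable I : T -> Prop.
Hypothesis adm : nichols_admissible I.

Definition homog_ge2 (s : T) := exists2 n, (2 <= n)%N & thomog n s.

Lemma admissible_mull a t : I t -> I (a ∗ t).
Proof.
case: adm => -[G [_ IG]] _ /IG It; apply/IG.
move: It; apply: span_lin; first by islin.
by move=> _ [b [s [c [Gs ->]]]]; apply: span_gen; exists (a ∗ b), s, c; rewrite !tmulA.
Qed.

Lemma admissible_mulr t a : I t -> I (t ∗ a).
Proof.
case: adm => -[G [_ IG]] _ /IG It; apply/IG.
move: It; apply: (span_lin (f := fun t => t ∗ a)); first by islin.
by move=> _ [b [s [c [Gs ->]]]]; apply: span_gen; exists b, s, (c ∗ a); rewrite !tmulA.
Qed.

(** An ideal generated by homogeneous elements is spanned by homogeneous elements, as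
    the cofactors can be taken to be words. *)
Lemma admissible_homog t : I t -> Defs.span (fun s => I s /\ homog_ge2 s) t.
Proof.
case: adm => -[G [G2 IG]] _ /IG; apply: span_sub => _ [a [s [b [Gs ->]]]].
have Is : I s by apply/IG/span_gen; exists (tone V), s, (tone V); rewrite tmul1l tmul1r.
have [n n2 Hs] := G2 s Gs.
pose Q := Defs.span (fun s => I s /\ homog_ge2 s); rewrite -/(Q _).
apply: (span_lin (f := fun b => a ∗ s ∗ b) _ _ (talg_span b)); first by islin.
move=> _ [v ->].
apply: (span_lin (f := fun a => a ∗ s ∗ word v) _ _ (talg_span a)); first by islin.
move=> _ [u ->]; apply: span_gen; split.
  by apply: admissible_mulr; apply: admissible_mull.
exists (size u + n + size v)%N; first by rewrite -addnA addnCA (leq_trans n2) // leq_addr.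
by apply: thomog_mul; [apply: thomog_mul => // | ]; exact: thomog_word.
Qed.

Lemma lin_tcounit : lin (@tcounit k V).
Proof.
apply: lin_wlift => -[|z u] v a x y; by rewrite /nilp /= scaler0 addr0.
Qed.

Lemma tcounit_homog_ge2 t : homog_ge2 t -> tcounit t = 0.
Proof.
case=> n n2; elim=> [|a s v [w sw ->] _ IH]; first exact: lin0 lin_tcounit.
rewrite lin_tcounit IH addr0 /tcounit wliftE.
  by rewrite /nilp sw; case: n n2 {sw} => //= n _; rewrite scaler0.
by move=> [|z u] v' b x y; rewrite /nilp /= scaler0 addr0.
Qed.

Section Image.
Variable D : (T -> T) -> Prop.
Definition image_span : T -> Prop :=
  Defs.span (fun s => exists d t, [/\ D d, I t & s = d t]).

Hypothesis Dlin : forall d, D d -> lin d.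
Hypothesis Dhom : forall d n t, D d -> thomog n t -> thomog n (d t).
Hypothesis Dmull : forall d a t, D d -> I t -> image_span (a ∗ d t).
Hypothesis Dmulr : forall d t a, D d -> I t -> image_span (d t ∗ a).
Hypothesis Dcomul : forall d t, D d -> I t ->
  Defs.span (fun u => exists a b, (image_span a \/ image_span b) /\ u = a ⊗ b) (tcomul (d t)).

(** The span of the images is required to be an ideal by itself. Passing to the ideal
    it generates would not do: the product of the braided algebra
    T(V) ⊗ T(V) involves the action and the coaction of H, so that showing the
    generated ideal to be a coideal would already require its stability. *)
Lemma image_admissible : nichols_admissible image_span.
Proof.
have Hh t : image_span t -> Defs.span (fun s => image_span s /\ homog_ge2 s) t.
  apply: span_sub => _ [d [u [Dd Iu ->]]].
  apply: (span_lin (Dlin Dd) _ (admissible_homog Iu)) => s [Is [n n2 Hs]].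
  apply: span_gen; split; first by apply: span_gen; exists d, s.
  by exists n => //; apply: Dhom.
split; last split.
- exists (fun s => image_span s /\ homog_ge2 s); split=> [s [_ //]|t]; split.
    move=> /Hh; apply: span_sub => s Ps; apply: span_gen.
    by exists (tone V), s, (tone V); rewrite tmul1l tmul1r.
  apply: span_sub => _ [a [s [b [[Js _] ->]]]].
  pose gen s := exists d t, [/\ D d, I t & s = d t].
  apply: (span_lin (f := fun t => a ∗ t ∗ b) (S := gen) _ _ Js); first by islin.
  move=> _ [d [u [Dd Iu ->]]].
  apply: (span_lin (f := fun t => t ∗ b) (S := gen) _ _ (Dmull a Dd Iu)); first by islin.
  by move=> _ [d' [u' [Dd' Iu' ->]]]; exact: Dmulr.
- move=> t /Hh; elim=> [|a s v [_ s2] _ IH].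
    exact: lin0 lin_tcounit.
  by rewrite lin_tcounit IH addr0 tcounit_homog_ge2 // scaler0.
- move=> t Jt; apply: (span_lin lin_tcomul _ Jt).
  by move=> _ [d [u [Dd Iu ->]]]; exact: Dcomul.
Qed.
End Image.

Lemma admissible_coideal t : I t ->
  Defs.span (fun u => exists a b, (I a \/ I b) /\ u = a ⊗ b) (tcomul t).
Proof. by case: adm => _ [_]; apply. Qed.

Hypothesis Sbij : bijective S.

(** With S' the inverse of S, the span of H . I is an ideal by
    a (h . t) = h_2 . ((S'(h_1) . a) t) and (h . t) a = h_1 . (t (S(h_2) . a)).
    It is a coideal because the coproduct is H-linear. *)
Lemma tact_image_admissible :
  nichols_admissible (image_span (fun d => exists h, d = tact h)).
Proof.
have [S' KS SK] := Sbij; have [S'l S'E] := antipV_skew SK KS.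
apply: image_admissible.
- by move=> _ [h ->]; islin.
- by move=> _ n t [h ->]; exact: thomog_tact.
- move=> _ a t [h ->] It.
  have -> : a ∗ tact h t = \sw_(h1, h2 <- Δ h) tact h2 (tact (S' h1) a ∗ t).
    symmetry; under eq_tlift => h1 h2.
      rewrite tactM; under eq_tlift => h21 h22 do rewrite -tact_mul.
      over.
    rewrite /= -(coassoc (F := fun h1 h2 h3 => tact (h2 * S' h1) a ∗ tact h3 t)); try by islin.
    under eq_tlift => h1 h2.
      rewrite (S'E _ (fun y => tact y a ∗ tact h2 t)); last by islin.
      rewrite tact_one; over.
    by rewrite (counitlE (F := fun h => a ∗ tact h t)) //; islin.
  apply: span_tlift => h1 h2; apply: span_gen; exists (tact h2), (tact (S' h1) a ∗ t).
  by split=> //; [exists h2 | apply: admissible_mull].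
- move=> _ t a [h ->] It.
  have -> : tact h t ∗ a = \sw_(h1, h2 <- Δ h) tact h1 (t ∗ tact (S h2) a).
    symmetry; under eq_tlift => h1 h2.
      rewrite tactM; under eq_tlift => h11 h12 do rewrite -tact_mul.
      over.
    rewrite /= (coassoc (F := fun h1 h2 h3 => tact h1 t ∗ tact (h2 * S h3) a)); try by islin.
    under eq_tlift => h1 h2.
      rewrite (antiprE (F := fun y => tact h1 t ∗ tact y a)); last by islin.
      rewrite tact_one; over.
    by rewrite (counitrE (F := fun h => tact h t ∗ a)) //; islin.
  apply: span_tlift => h1 h2; apply: span_gen; exists (tact h1), (t ∗ tact (S h2) a).
  by split=> //; [exists h1 | apply: admissible_mulr].
- move=> _ t [h ->] It; rewrite tcomul_tact; apply: span_tlift => h1 h2.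
  have L : lin (tlift (fun a b : T => tact h1 a ⊗ tact h2 b)) by islin.
  apply: (span_lin L _ (admissible_coideal It)) => _ [a [b [Iab ->]]].
  rewrite tliftE; last by islin.
  apply: span_gen; exists (tact h1 a), (tact h2 b); split=> //.
  by case: Iab => [Ia|Ib]; [left; apply: span_gen; exists (tact h1), a
    | right; apply: span_gen; exists (tact h2), b]; split=> //; [exists h1 | exists h2].
Qed.

(** Here the ideal property comes from
    a t_0 f(t_(-1)) = f(S(a_(-2)) a_(-1) t_(-1)) a_0 t_0 and
    t_0 a f(t_(-1)) = f(t_(-1) a_(-1) S'(a_(-2))) t_0 a_0,
    and the coideal property from the colinearity of the coproduct. *)
Lemma hit_image_admissible :
  nichols_admissible (image_span (fun d => exists2 f, lin f & d = hit f)).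
Proof.
have [S' KS SK] := Sbij; have [S'l S'E] := antipV_skew SK KS.
have hitI f t : lin f -> I t -> image_span (fun d => exists2 f, lin f & d = hit f) (hit f t).
  by move=> fl It; apply: span_gen; exists (hit f), t; split=> //; exists f.
apply: image_admissible.
- by move=> _ [f fl ->]; exact: lin_hit.
- by move=> _ n t [f fl ->]; exact: thomog_hit.
- move=> _ a t [f fl ->] It.
  have -> : a ∗ hit f t = \sw_(g, a0 <- tcoact a) hit (fun y => f (S g * y)) (a0 ∗ t).
    symmetry; under eq_tlift => g a0.
      rewrite /hit tcoactM; last by islin.
      under eq_tlift => g1 a00 do under eq_tlift => g' t0 do rewrite mulrA.
      over.
    rewrite /= -(tcoact_coassoc (F := fun g g1 a0 =>
      \sw_(g', t0 <- tcoact t) f (S g * g1 * g') *: (a0 ∗ t0))); try by islin.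
    under eq_tlift => g a0.
      rewrite (antiplE (F := fun y =>
        \sw_(g', t0 <- tcoact t) f (y * g') *: (a0 ∗ t0))); last by islin.
      under [X in _ *: X]eq_tlift => g' t0 do
        rewrite mul1r -(linZ _ _ (bil_r _ (tmul_bilinear V))).
      rewrite -(tlift_map _ _ (bil_r _ (tmul_bilinear V))); over.
    by rewrite -/(hit f t) (tcoact_counit (F := fun a => a ∗ hit f t)) //; islin.
  apply: span_tlift => g a0; apply: hitI; first by islin.
  exact: admissible_mull.
- move=> _ t a [f fl ->] It.
  have -> : hit f t ∗ a = \sw_(g, a0 <- tcoact a) hit (fun y => f (y * S' g)) (t ∗ a0).
    symmetry; under eq_tlift => g a0.
      rewrite /hit tcoactM; last by islin.
      under eq_tlift => g' t0 do under eq_tlift => g1 a00 do rewrite -mulrA.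
      rewrite tlift_exchange; over.
    rewrite /= -(tcoact_coassoc (F := fun g g1 a0 =>
      \sw_(g', t0 <- tcoact t) f (g' * (g1 * S' g)) *: (t0 ∗ a0))); try by islin.
    under eq_tlift => g a0.
      rewrite (S'E _ (fun y =>
        \sw_(g', t0 <- tcoact t) f (g' * y) *: (t0 ∗ a0))); last by islin.
      under [X in _ *: X]eq_tlift => g' t0 do
        rewrite mulr1 -(linZ _ _ (bil_l _ (tmul_bilinear V))).
      rewrite -(tlift_map _ _ (bil_l _ (tmul_bilinear V))); over.
    by rewrite -/(hit f t) (tcoact_counit (F := fun a => hit f t ∗ a)) //; islin.
  apply: span_tlift => g a0; apply: hitI; first by islin.
  exact: admissible_mulr.
- move=> _ t [f fl ->] It.
  have -> : tcomul (hit f t) = \sw_(a, b <- tcomul t) \sw_(g, a0 <- tcoact a) \sw_(g', b0 <- tcoact b)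
      f (g * g') *: (a0 ⊗ b0).
    rewrite -(tcoact_tcomul (F := fun g s => f g *: s)); last by islin.
    rewrite /hit (tlift_map _ _ lin_tcomul); apply: eq_tlift => g t0.
    by rewrite (linZ _ _ lin_tcomul).
  have L : lin (tlift (fun a b : T => \sw_(g, a0 <- tcoact a) \sw_(g', b0 <- tcoact b)
      f (g * g') *: (a0 ⊗ b0))) by islin.
  apply: (span_lin L _ (admissible_coideal It)) => _ [a [b [Iab ->]]].
  rewrite tliftE; last by islin.
  case: Iab => [Ia|Ib].
    rewrite tlift_exchange; apply: span_tlift => g' b0.
    have -> : \sw_(g, a0 <- tcoact a) f (g * g') *: (a0 ⊗ b0) = hit (fun g => f (g * g')) a ⊗ b0.
      rewrite /hit (tlift_map _ _ (bil_l _ (tens_bilinear T T))); apply: eq_tlift => g a0.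
      by rewrite (linZ _ _ (bil_l _ (tens_bilinear T T))).
    apply: span_gen; exists (hit (fun g => f (g * g')) a), b0; split=> //; left.
    by apply: hitI => //; islin.
  apply: span_tlift => g a0.
  have -> : \sw_(g', b0 <- tcoact b) f (g * g') *: (a0 ⊗ b0) = a0 ⊗ hit (fun g' => f (g * g')) b.
    rewrite /hit (tlift_map _ _ (bil_r _ (tens_bilinear T T))); apply: eq_tlift => g' b0.
    by rewrite (linZ _ _ (bil_r _ (tens_bilinear T T))).
  apply: span_gen; exists a0, (hit (fun g' => f (g * g')) b); split=> //; right.
  by apply: hitI => //; islin.
Qed.

End Ideal.
End Admissible.

(** * Structure maps of the Nichols algebra and of its bosonization *)

Section Nichols.
Variables (k : fieldType) (H : hopfAlg k) (V : ydMod H).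
Local Notation T := (talg V).
Local Notation B := (nichols V).
Local Notation Δ := (comul H).
Local Notation ε := (counit H).
Local Notation S := (antip H).
Local Notation δ := (coact V).
Local Notation "s ∗ t" := (tmul s t) (at level 40, left associativity).
Local Notation ι x := (word [:: x]).
Local Notation npi := (@npi k H V).

Lemma lin_npi : lin npi.
Proof. by move=> a s t; rewrite /Defs.npi linearP. Qed.
Hint Extern 0 (lin _) => exact: lin_npi : bilin.

Lemma lin_nincl : lin (@nincl k H V).
Proof. by rewrite /nincl; islin. Qed.
Hint Extern 0 (lin _) => exact: lin_nincl : bilin.

Lemma npi_gen t : nichols_gen t -> npi t = 0.
Proof.
by move=> Nt; rewrite -(lin0 lin_npi); apply/qclassP; rewrite subr0; apply: span_gen.
Qed.

(** A linear map on T(V) that vanishes on the admissible ideals does not see the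
    choice of representatives. *)
Lemma npi_lift (U : lmodType k) (F : T -> U) t : lin F ->
  (forall t, nichols_gen t -> F t = 0) -> F (repr (npi t)) = F t.
Proof.
move=> Fl F0; apply/eqP; rewrite -subr_eq0 -scaleN1r addrC -Fl scaleN1r addrC; apply/eqP.
elim: (qrepr (@nichols_gen k H V) t) => [|a s w Ss _ IH]; first exact: lin0 Fl.
by rewrite Fl F0 // IH scaler0 addr0.
Qed.

Lemma lin_npi_lift (U : lmodType k) (F : T -> U) : lin F ->
  (forall t, nichols_gen t -> F t = 0) -> lin (fun b : B => F (repr b)).
Proof.
move=> Fl F0 a b c; rewrite -(qclassK b) -(qclassK c) -[qclass _ _]/(npi _).
by rewrite -[X in a *: _ + X]/(npi _) -lin_npi !npi_lift.
Qed.

Hypothesis Sbij : bijective S.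

Lemma nmul_bilinear : bilinear_map (@nmul k H V).
Proof.
apply: bilP => [c|b].
  apply: (lin_npi_lift (F := fun s => npi (s ∗ repr c))); first by islin.
  by move=> t [I adm It]; apply: npi_gen; exists I => //; exact: admissible_mulr.
apply: (lin_npi_lift (F := fun s => npi (repr b ∗ s))); first by islin.
by move=> t [I adm It]; apply: npi_gen; exists I => //; exact: admissible_mull.
Qed.

(** Admissibility of the span of H . I puts h . t into an admissible ideal, though
    in general not into the one that contained t. *)
Lemma nact_gen h t : nichols_gen t -> npi (tact h t) = 0.
Proof.
case=> I adm It; apply: npi_gen.
exists (image_span I (fun d => exists h, d = tact h)); first exact: tact_image_admissible.
by apply: span_gen; exists (tact h), t; split=> //; exists h.
Qed.

Lemma nact_bilinear : bilinear_map (@nact k H V).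
Proof.
apply: bilP => [b|h]; first by rewrite /nact; islin.
by apply: (lin_npi_lift (F := fun s => npi (tact h s))); [islin | exact: nact_gen].
Qed.

(** It suffices to apply f ⊗ id for each functional f on H, and the outcome is then
    the class of [hit f t], which lies in an admissible ideal. *)
Lemma ncoact_gen t : nichols_gen t -> \sw_(g, s <- tcoact t) g ⊗ npi s = 0.
Proof.
case=> I adm It; apply: tensor_eq0 => f fl.
have L : lin (tlift (fun g b => f g *: b : B)) by islin.
rewrite (tlift_map _ _ L).
under eq_tlift => g s do [rewrite tliftE; last (by islin); rewrite -(linZ _ _ lin_npi)].
rewrite -(tlift_map _ _ lin_npi); apply: npi_gen.
exists (image_span I (fun d => exists2 f, lin f & d = hit f)); first exact: hit_image_admissible.
by apply: span_gen; exists (hit f), t; split=> //; exists f.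
Qed.

Lemma lin_ncoact : lin (@ncoact k H V).
Proof.
apply: (lin_npi_lift (F := fun s => \sw_(g, t <- tcoact s) g ⊗ npi t)); first by islin.
exact: ncoact_gen.
Qed.

Lemma ncomul_gen t : nichols_gen t -> \sw_(s, u <- tcomul t) npi s ⊗ npi u = 0.
Proof.
case=> I adm It; have L : lin (tlift (fun s u : T => npi s ⊗ npi u)) by islin.
elim: (admissible_coideal adm It) => [|a r w [b [c [Ibc ->]]] _ IH]; first exact: lin0 L.
rewrite L IH addr0 tliftE; last by islin.
have np s : I s -> npi s = 0 by move=> Is; apply: npi_gen; exists I.
case: Ibc => /np ->; first by rewrite (lin0 (bil_l _ (tens_bilinear B B))) scaler0.
by rewrite (lin0 (bil_r _ (tens_bilinear B B))) scaler0.
Qed.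

Lemma lin_ncomul : lin (@ncomul k H V).
Proof.
apply: (lin_npi_lift (F := fun t => \sw_(s, u <- tcomul t) npi s ⊗ npi u)); first by islin.
exact: ncomul_gen.
Qed.

Lemma ncounit_gen (t : T) : @nichols_gen k H V t -> tcounit t = 0.
Proof. by case=> I [_ [+ _]] It; apply. Qed.

Lemma lin_ncounit : lin (@ncounit k H V).
Proof. exact: (lin_npi_lift (@lin_tcounit k H V) ncounit_gen). Qed.

Lemma ncomul_one : ncomul (none V) = none V ⊗ none V.
Proof.
rewrite /ncomul /none (npi_lift (F := fun t => \sw_(s, u <- tcomul t) npi s ⊗ npi u)).
- by rewrite tcomul_tone tliftE //; islin.
- by islin.
- exact: ncomul_gen.
Qed.

Lemma ncomul_incl x :
  @ncomul k H V (nincl x) = nincl x ⊗ none V + none V ⊗ nincl x.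
Proof.
rewrite /ncomul /nincl (npi_lift (F := fun t => \sw_(s, u <- tcomul t) npi s ⊗ npi u)).
- rewrite -[word [:: x] in LHS]tmul1r tcomul_cons tcomul_tone tlift_tcomul_letter; last by islin.
  rewrite tliftE; last by islin.
  rewrite tmul1r; congr (_ + _).
  rewrite -(coact_counit (F := fun x => none V ⊗ npi (ι x))); last by islin.
  apply: eq_tlift => g x0; rewrite tact_tone tmul1r (linZ _ _ lin_npi).
  by rewrite (linZ _ _ (bil_l _ (tens_bilinear B B))).
- by islin.
- exact: ncomul_gen.
Qed.

Lemma ncoact_one : ncoact (none V) = 1 ⊗ none V.
Proof.
rewrite /ncoact /none (npi_lift (F := fun t => \sw_(g, s <- tcoact t) g ⊗ npi s)).
- by rewrite tcoact_tone tliftE //; islin.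
- by islin.
- exact: ncoact_gen.
Qed.

Lemma ncoact_incl x : @ncoact k H V (nincl x) = \sw_(g, x0 <- δ x) g ⊗ nincl x0.
Proof.
rewrite /ncoact /nincl (npi_lift (F := fun t => \sw_(g, s <- tcoact t) g ⊗ npi s)).
- rewrite -[word [:: x] in LHS]tmul1r tcoact_consE; last by islin.
  by apply: eq_tlift => g x0; rewrite tcoact_tone tliftE ?mulr1 ?tmul1r //; islin.
- by islin.
- exact: ncoact_gen.
Qed.

Lemma ncounit_one : @ncounit k H V (none V) = 1.
Proof.
rewrite /ncounit /none npi_lift; [|exact: (@lin_tcounit k H V)|exact: ncounit_gen].
rewrite /tcounit wliftE // => -[|z u] v a x y; by rewrite /nilp /= scaler0 addr0.
Qed.

Lemma ncounit_incl x : @ncounit k H V (nincl x) = 0.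
Proof.
rewrite /ncounit /nincl npi_lift; [|exact: (@lin_tcounit k H V)|exact: ncounit_gen].
rewrite /tcounit wliftE // => -[|z u] v a y y'; by rewrite /nilp /= scaler0 addr0.
Qed.

Lemma nmul_one_one : @nmul k H V (none V) (none V) = none V.
Proof.
rewrite /nmul /none -[RHS](congr1 npi (tmul1l (tone V))).
rewrite (npi_lift (F := fun s => npi (s ∗ repr (npi (tone V))))).
- rewrite (npi_lift (F := fun s => npi (tone V ∗ s))) //; first by islin.
  by move=> t [I adm It]; apply: npi_gen; exists I => //; exact: admissible_mull.
- by islin.
- by move=> t [I adm It]; apply: npi_gen; exists I => //; exact: admissible_mulr.
Qed.

Lemma nact1_one : @nact k H V 1 (none V) = none V.
Proof.
rewrite /nact /none (npi_lift (F := fun s => npi (tact 1 s))) ?tact_one //; first by islin.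
exact: nact_gen.
Qed.

Section Bosonization.
Local Notation A := (bosonization V).
Hint Extern 0 (lin _) => exact: lin_ncomul : bilin.
Hint Extern 0 (lin _) => exact: lin_ncoact : bilin.
Hint Extern 0 (lin _) => exact: lin_ncounit : bilin.
Hint Extern 0 (bilinear_map _) => exact: nmul_bilinear : bilin.
Hint Extern 0 (bilinear_map _) => exact: nact_bilinear : bilin.

Lemma smash_bilinear : bilinear_map (@smash k H V).
Proof. exact: tens_bilinear. Qed.
Hint Extern 0 (bilinear_map _) => exact: smash_bilinear : bilin.

Lemma bcomul_bil : bilinear_map (fun (b : B) (h : H) => \sw_(b1, b2 <- ncomul b)
    \sw_(g, b20 <- ncoact b2) \sw_(h1, h2 <- Δ h) tens (b1 ⊗ (g * h1)) (b20 ⊗ h2)).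
Proof. by islin. Qed.

Lemma lin_bcomul : lin (@bcomul k A).
Proof. exact: lin_tlift bcomul_bil. Qed.

Lemma bcounit_bil : bilinear_map (fun (b : B) (h : H) => ncounit b * ε h : k^o).
Proof. by islin. Qed.

Lemma lin_bcounit : lin (@bcounit k A).
Proof. exact: lin_tlift bcounit_bil. Qed.

Lemma bmul_bilinear : bilinear_map (@bmul k A).
Proof. by rewrite /=; islin. Qed.

Lemma bcomul_smash (b : B) h : bcomul (smash b h) = \sw_(b1, b2 <- ncomul b)
    \sw_(g, b20 <- ncoact b2) \sw_(h1, h2 <- Δ h)
      @smash k H V b1 (g * h1) ⊗ @smash k H V b20 h2.
Proof. by rewrite /= /smash (tliftE bcomul_bil). Qed.

Lemma bcomul_grouplike g : grouplike g ->
  bcomul (smash (none V) g) = smash (none V) g ⊗ smash (none V) g.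
Proof.
case=> Δg _; rewrite bcomul_smash ncomul_one tliftE; last by islin.
rewrite ncoact_one tliftE; last by islin.
by rewrite Δg tliftE ?mul1r //; islin.
Qed.

(** With the coaction of x given by g, the letter x is skew primitive in B(V) # H:
    the braided coproduct has the two terms x ⊗ 1 and 1 ⊗ x, and the coaction of the
    second factor puts g on the left of the second term. *)
Lemma bcomul_primitive x g : δ x = g ⊗ x ->
  bcomul (smash (nincl x) 1)
  = smash (nincl x) 1 ⊗ bone A + smash (none V) g ⊗ smash (nincl x) 1.
Proof.
move=> δx; rewrite bcomul_smash ncomul_incl (linD _ _ (lin_tlift _)); last by islin.
rewrite !tliftE; try by islin.
rewrite ncoact_one ncoact_incl δx tliftE; last by islin.
rewrite !tliftE; try by islin.
by rewrite comul1 !tliftE ?mulr1 //; islin.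
Qed.

Lemma bcounit_smash (b : B) h : bcounit (smash b h) = ncounit b * ε h.
Proof. by rewrite /= /smash (tliftE bcounit_bil). Qed.

Lemma bmul_one_one : bmul (bone A) (bone A) = bone A.
Proof.
rewrite /= tliftE; last by islin.
rewrite tliftE; last by islin.
by rewrite comul1 tliftE ?nact1_one ?nmul_one_one ?mulr1 //; islin.
Qed.
End Bosonization.
End Nichols.

(** * Convolution and twisting on skew primitive elements *)

Section Twist.
Variables (k : fieldType) (A : bialgOps k).
Hypothesis lin_comul : lin (@bcomul k A).
Hypothesis lin_counit : lin (@bcounit k A).
Implicit Types (f s : A ⊗ A -> k^o) (a b g z : A).

Lemma conv_bil f f' : lin f -> lin f' -> bilinear_map (fun a b =>
  \sw_(a1, a2 <- bcomul a) \sw_(b1, b2 <- bcomul b) (f (a1 ⊗ b1) * f' (a2 ⊗ b2) : k^o)).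
Proof. by move=> fl fl'; islin. Qed.

Lemma lin_conv f f' : lin f -> lin f' -> lin (conv f f').
Proof. by move=> fl fl'; apply: lin_tlift; exact: conv_bil. Qed.

Lemma conv1_bil : bilinear_map (fun a b => bcounit a * bcounit b : k^o).
Proof. by islin. Qed.

Lemma lin_conv1 : lin (@conv1 k A).
Proof. by apply: lin_tlift; exact: conv1_bil. Qed.

Lemma conv1E a b : conv1 (a ⊗ b) = bcounit a * bcounit b.
Proof. by rewrite /conv1 tliftE //; exact: conv1_bil. Qed.

Lemma lin_conv_pow f n : lin f -> lin (conv_pow f n).
Proof. by move=> fl; elim: n => [|n IH]; [exact: lin_conv1 | exact: lin_conv]. Qed.

Definition bgrouplike g := bcomul g = g ⊗ g.
Definition skew_primitive g z := bcomul z = z ⊗ bone A + g ⊗ z.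

Section Conv.
Variables f f' : A ⊗ A -> k^o.
Hypotheses (fl : lin f) (fl' : lin f').
Variables g1 g2 z1 z2 : A.
Hypotheses (G1 : bgrouplike g1) (G2 : bgrouplike g2).
Hypotheses (P1 : skew_primitive g1 z1) (P2 : skew_primitive g2 z2).

Lemma conv_tens a b : conv f f' (a ⊗ b) =
  \sw_(a1, a2 <- bcomul a) \sw_(b1, b2 <- bcomul b) (f (a1 ⊗ b1) * f' (a2 ⊗ b2) : k^o).
Proof. by rewrite /conv tliftE //; exact: conv_bil. Qed.

Lemma tlift_primitive (U : lmodType k) (F : A -> A -> U) g z : skew_primitive g z ->
  bilinear_map F -> tlift F (bcomul z) = F z (bone A) + F g z.
Proof. by move=> Pz Fl; rewrite Pz (linD _ _ (lin_tlift Fl)) !(tliftE Fl). Qed.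

Lemma tlift_grouplike (U : lmodType k) (F : A -> A -> U) g : bgrouplike g ->
  bilinear_map F -> tlift F (bcomul g) = F g g.
Proof. by move=> Gg Fl; rewrite Gg (tliftE Fl). Qed.

Lemma conv_grouplike : conv f f' (g1 ⊗ g2) = f (g1 ⊗ g2) * f' (g1 ⊗ g2).
Proof.
rewrite conv_tens (tlift_grouplike G1); last by islin.
by rewrite (tlift_grouplike G2) //; islin.
Qed.

Lemma conv_primitivel :
  conv f f' (z1 ⊗ g2) = f (z1 ⊗ g2) * f' (bone A ⊗ g2) + f (g1 ⊗ g2) * f' (z1 ⊗ g2).
Proof.
rewrite conv_tens (tlift_primitive P1); last by islin.
by rewrite !(tlift_grouplike G2) //; islin.
Qed.

Lemma conv_primitiver :
  conv f f' (g1 ⊗ z2) = f (g1 ⊗ z2) * f' (g1 ⊗ bone A) + f (g1 ⊗ g2) * f' (g1 ⊗ z2).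
Proof.
rewrite conv_tens (tlift_grouplike G1); last by islin.
by rewrite (tlift_primitive P2) //; islin.
Qed.

Lemma conv_primitive : conv f f' (z1 ⊗ z2) =
  f (z1 ⊗ z2) * f' (bone A ⊗ bone A) + f (z1 ⊗ g2) * f' (bone A ⊗ z2)
  + (f (g1 ⊗ z2) * f' (z1 ⊗ bone A) + f (g1 ⊗ g2) * f' (z1 ⊗ z2)).
Proof.
rewrite conv_tens (tlift_primitive P1); last by islin.
by rewrite !(tlift_primitive P2) //; islin.
Qed.
End Conv.

Lemma conv_invP s : (exists r, conv_inverse s r) -> conv_inverse s (conv_inv s).
Proof. by move=> ex; rewrite /conv_inv; case: pselect => // e; case: cid. Qed.

Hypothesis mul_bilinear : bilinear_map (@bmul k A).
Hypothesis mul_one_one : bmul (bone A) (bone A) = bone A.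

(** Each iterated coproduct z ⊗ 1 ⊗ 1 + g ⊗ z ⊗ 1 + g ⊗ g ⊗ z has three terms, so the
    twisted product has nine. The values of s on (z1, g2) and (g1, z2) and those of
    its inverse on (z1, 1) and (1, z2) vanish, which leaves the terms of the two
    outer pairs and of the middle pair; the inverse takes the value
    - s(z1 ⊗ z2) on z1 ⊗ z2. *)
Lemma twist_mul_primitive s g1 g2 z1 z2 :
  mult_2cocycle s -> bgrouplike (bone A) -> bcounit (bone A) = 1 ->
  bgrouplike g1 -> bgrouplike g2 -> bcounit g1 = 1 -> bcounit g2 = 1 ->
  skew_primitive g1 z1 -> skew_primitive g2 z2 ->
  bcounit z1 = 0 -> bcounit z2 = 0 ->
  s (g1 ⊗ g2) = 1 -> s (z1 ⊗ g2) = 0 -> s (g1 ⊗ z2) = 0 ->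
  twist_mul s z1 z2 = s (z1 ⊗ z2) *: (bone A - bmul g1 g2) + bmul z1 z2.
Proof.
move=> [sl sinv _ s1] Ge ee G1 G2 e1 e2 P1 P2 ez1 ez2 sgg szg sgz.
have {}sl : lin s by exact: sl.
have [tl st _] := conv_invP sinv; set t := conv_inv s in tl st *; have {}tl : lin t by exact: tl.
have t11 : t (bone A ⊗ bone A) = 1.
  have := congr1 (fun f => f (bone A ⊗ bone A)) st.
  by rewrite conv_grouplike // conv1E ee (s1 _).1 ee !mul1r.
have tz1 : t (z1 ⊗ bone A) = 0.
  have := congr1 (fun f => f (z1 ⊗ bone A)) st.
  by rewrite (conv_primitivel sl tl Ge P1) conv1E !(s1 _).1 ez1 e1 !mul0r add0r mul1r.
have t1z : t (bone A ⊗ z2) = 0.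
  have := congr1 (fun f => f (bone A ⊗ z2)) st.
  by rewrite (conv_primitiver sl tl Ge P2) conv1E !(s1 _).2 ez2 e2 mulr0 !mul0r add0r mul1r.
(* Comparing s * t with the convolution unit at z1 ⊗ z2, where only the two extreme
   terms s(z1, z2) t(1, 1) and s(g1, g2) t(z1, z2) are left. *)
have tzz : t (z1 ⊗ z2) = - s (z1 ⊗ z2).
  have := congr1 (fun f => f (z1 ⊗ z2)) st.
  rewrite (conv_primitive sl tl P1 P2) conv1E t11 t1z tz1 sgg ez1.
  rewrite !mulr1 !mulr0 !mul0r mul1r addr0 add0r.
  by move/eqP; rewrite addrC addr_eq0 => /eqP.
have s11 : s (bone A ⊗ bone A) = 1 by rewrite (s1 _).1.
rewrite /twist_mul (tlift_primitive P1); last by islin.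
rewrite (tlift_grouplike Ge); last by islin.
rewrite (tlift_primitive P1); last by islin.
rewrite !(tlift_primitive P2); try by islin.
rewrite !(tlift_grouplike Ge); try by islin.
rewrite -/t szg sgz sgg t11 t1z tz1 tzz.
rewrite !(mul0r, mulr0, mul1r, mulr1) !scale0r !scale1r mul_one_one !(addr0, add0r).
rewrite scalerBr scaleNr -!addrA; congr (_ + _); exact: addrC.
Qed.
End Twist.

Section ConvExp.
Variables (k : fieldType) (A : bialgOps k) (f : A ⊗ A -> k^o) (t : A ⊗ A).

Lemma conv_exp_single n : (forall i, i != n -> conv_pow f i t = 0) ->
  conv_exp f t = n`!%:R^-1 * conv_pow f n t.
Proof.
move=> E; rewrite /conv_exp -(fsbig_widen [set n]%classic) ?fsbig_set1 //.
by move=> i [_ /= /eqP ni]; rewrite E ?mulr0.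
Qed.
End ConvExp.

Theorem lemma2p7 (k : closedFieldType) (char0 : [pchar k] =i pred0)
    (H : hopfAlg k) (antip_bij : bijective (antip H)) (V : ydMod H)
    (eta : {linear (V ⊗ V)%type -> k^o}) (eta_inv : invariant_form eta)
    (sigma_cocycle : mult_2cocycle (conv_exp (eta_tilde eta)))
    (x1 x2 : V) (h1 h2 : H)
    (h1G : grouplike h1) (h2G : grouplike h2)
    (dx1 : coact V x1 = h1 ⊗ x1) (dx2 : coact V x2 = h2 ⊗ x2) :
  let A := bosonization V in
  let sigma := conv_exp (eta_tilde eta) in
  let z1 : A := smash (nincl x1) 1 in
  let z2 : A := smash (nincl x2) 1 in
  let g1 : A := smash (none V) h1 in
  let g2 : A := smash (none V) h2 in
  sigma (z1 ⊗ z2) = eta (x1 ⊗ x2) /\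
  twist_mul sigma z1 z2 = eta (x1 ⊗ x2) *: (bone A - bmul g1 g2) + bmul z1 z2.
Proof.
move=> A sigma z1 z2 g1 g2.
have Gone : grouplike (1 : H) by split; [exact: comul1 | exact: counit1].
have cl : lin (@bcomul k A) by exact: lin_bcomul.
have el : lin (@bcounit k A) by exact: lin_bcounit.
have fl : lin (eta_tilde eta) by exact: eta_tilde_linear.
have Ge : bgrouplike (bone A) by exact: bcomul_grouplike.
have G1 : bgrouplike g1 by exact: bcomul_grouplike.
have G2 : bgrouplike g2 by exact: bcomul_grouplike.
have P1 : skew_primitive g1 z1 by exact: bcomul_primitive.
have P2 : skew_primitive g2 z2 by exact: bcomul_primitive.
have eg h : grouplike h -> bcounit (smash (none V) h : A) = 1.
  by case=> _ eh; rewrite bcounit_smash // ncounit_one eh mulr1.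
have ez x : bcounit (smash (nincl x) 1 : A) = 0.
  by rewrite bcounit_smash // ncounit_incl mul0r.
have H0 h : bos_homog 0 (smash (none V) h).
  by apply: span_gen; exists (tone V), h; split=> //; exact: (thomog_word [::]).
have H1 (x : V) : bos_homog 1 (smash (nincl x) 1).
  by apply: span_gen; exists (word [:: x]), 1; split=> //; exact: (thomog_word [:: x]).
(* The form lives in bidegree (1, 1), so it vanishes as soon as one argument has
   degree 0. *)
have f0l h a n : bos_homog n a -> eta_tilde eta (smash (none V) h ⊗ a) = 0.
  by move=> Ha; apply: (eta_tilde_homog _ (H0 h) Ha).
have f0r h a n : bos_homog n a -> eta_tilde eta (a ⊗ smash (none V) h) = 0.
  by move=> Ha; apply: (eta_tilde_homog _ Ha (H0 h)); case: n Ha => [|[]].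
pose P := conv_pow (eta_tilde eta).
have Pl n : lin (P n) by exact: lin_conv_pow.
have Pgg (n : nat) h h' : grouplike h -> grouplike h' -> n != 0%N ->
    P n (smash (none V) h ⊗ smash (none V) h') = 0.
  case: n => // n Gh Gh' _.
  rewrite /P /= conv_grouplike ?(f0l _ _ _ (H0 h')) ?mul0r //; exact: bcomul_grouplike.
have P0gg h h' : grouplike h -> grouplike h' ->
    P 0 (smash (none V) h ⊗ smash (none V) h') = 1.
  by move=> Gh Gh'; rewrite /P /= conv1E // !eg // mulr1.
have sE t (n : nat) : (forall i, i != n -> P i t = 0) -> sigma t = n`!%:R^-1 * P n t.
  exact: conv_exp_single.
have sgg : sigma (g1 ⊗ g2) = 1.
  by rewrite (sE _ 0%N) ?P0gg ?invr1 ?mulr1 // => i i0; exact: Pgg.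
have szg : sigma (z1 ⊗ g2) = 0.
  have Pzg i : P i (z1 ⊗ g2) = 0.
    case: i => [|i]; first by rewrite /P /= conv1E // ez mul0r.
    rewrite /P /= (conv_primitivel cl fl (Pl i) G2 P1).
    by rewrite (f0r _ _ _ (H1 x1)) (f0l _ _ _ (H0 h2)) !mul0r addr0.
  by rewrite (sE _ 0%N) // Pzg mulr0.
have sgz : sigma (g1 ⊗ z2) = 0.
  have Pgz i : P i (g1 ⊗ z2) = 0.
    case: i => [|i]; first by rewrite /P /= conv1E // ez mulr0.
    rewrite /P /= (conv_primitiver cl fl (Pl i) G1 P2).
    by rewrite (f0l _ _ _ (H1 x2)) (f0l _ _ _ (H0 h2)) !mul0r addr0.
  by rewrite (sE _ 0%N) // Pgz mulr0.
(* Of the four terms of the convolution only the one with both letters in the first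
   factor survives; it leaves the power i at 1 ⊗ 1, which is zero unless i = 0. *)
have Pzz i : P i.+1 (z1 ⊗ z2) = eta (x1 ⊗ x2) * P i (bone A ⊗ bone A).
  rewrite /P /= (conv_primitive cl fl (Pl i) P1 P2) (f0l _ _ _ (H1 x2)) (f0l _ _ _ (H0 h2)).
  by rewrite (f0r _ _ _ (H1 x1)) !mul0r !addr0 eta_tildeE counit1 mulr1 act1.
have szz : sigma (z1 ⊗ z2) = eta (x1 ⊗ x2).
  rewrite (sE _ 1%N) ?Pzz ?P0gg ?invr1 ?mulr1 ?mul1r // => -[|[|i]] // _.
    by rewrite /P /= conv1E // ez mul0r.
  by rewrite Pzz Pgg ?mulr0.
split=> //; rewrite -szz; apply: twist_mul_primitive; rewrite ?eg ?ez //.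
- exact: bmul_bilinear.
- exact: bmul_one_one.
Qed.
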